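(* Let $\Pi\colon M\to N$ be a surjective map of constant rank between smooth manifolds, with $1\le p<\dim N<\dim M$, and let a Lie group $G$ act projectably on $M$. If $I\colon J^k(N,p)\to\mathbb{R}$ is a differential invariant for the prolonged action of $[G]$ on $N$, then $\widehat I=I\circ\Pi^{(k)}\colon J^k_\Pi(M,p)\to\mathbb{R}$ is a differential invariant for the prolonged action of $G$ on $M$, with domain $\operatorname{dom}\widehat I=(\Pi^{(k)})^{-1}(\operatorname{dom}I)$.
   Context: All objects are smooth ($C^\infty$). For $v\in N$, $\mathcal{F}_v=\Pi^{-1}\{v\}$ is the fiber over $v$. The action of $G$ on $M$ is projectable under $\Pi$ if for all $v\in N$, $g\in G$ there is $\bar v\in N$ with $g\cdot\mathcal{F}_v=\mathcal{F}_{\bar v}$; then $g\cdot v:=\bar v$ defines an action of $G$ on $N$, with global isotropy subgroup $G_N^*=\{g\in G: g\cdot v=v\ \forall v\in N\}$, and $[G]=G/G_N^*$ acts effectively on $N$. $J^k(M,p)$ is the $k$-th order extended jet bundle: equivalence classes of $p$-dimensional submanifolds of $M$ under $k$-th order contact at a point; $\mathrm{j}_kS|_z$ denotes the $k$-jet of $S$ at $z\in S$. A $p$-dimensional submanifold $S\subset M$ is $\Pi$-regular if $T_zS\cap\ker d\Pi|_z=\{0\}$ for all $z\in S$. $J^k_\Pi(M,p)\subset J^k(M,p)$ is the open dense subset of $k$-jets of $\Pi$-regular submanifolds (for $k\geq1$, an open condition on 1-jets). The map $\Pi^{(k)}\colon J^k_\Pi(M,p)\to J^k(N,p)$ is $\Pi^{(k)}(\mathrm{j}_kS|_z)=\mathrm{j}_k\Pi(S)|_{\Pi(z)}$.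 The prolonged action is $g^{(k)}\cdot \mathrm{j}_kS|_z=\mathrm{j}_k(g\cdot S)|_{g\cdot z}$, and similarly for $[G]$ on $J^k(N,p)$. A differential function of order $k$ is a real-valued function defined on an open subset $\operatorname{dom}F$ of $J^k$ (the notation $F\colon J^k\to\mathbb{R}$ allows such partial domains). A differential invariant is a differential function $I$ with $I(g^{(k)}\cdot z^{(k)})=I(z^{(k)})$ whenever both $z^{(k)}$ and $g^{(k)}\cdot z^{(k)}$ belong to $\operatorname{dom}I$. *)

(* Defs.v *)
(* MathComp-Analysis; the reals are an arbitrary R : realType. *)
From HB Require Import structures.
From mathcomp Require Import all_boot all_order all_algebra.
From mathcomp Require Import all_classical all_reals all_analysis.
Set Implicit Arguments.
Unset Strict Implicit.
Unset Printing Implicit Defensive.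
Import Order.TTheory GRing.Theory Num.Theory.
Import numFieldNormedType.Exports.
Local Open Scope classical_set_scope.
Local Open Scope ring_scope.

(** ** Smooth functions between normed spaces *)

Definition iter_derive (R : realType) (V W : normedModType R)
    (vs : seq V) (f : V -> W) : V -> W :=
  foldr (fun v g x => 'D_v g x) f vs.

(* Used for open U only: every iterated directional derivative exists on U and
   is Frechet differentiable there, i.e. f is C^oo on U. *)
Definition smooth_on (R : realType) (V W : normedModType R)
    (U : set V) (f : V -> W) : Prop :=
  forall (vs : seq V) (x : V), U x -> differentiable (iter_derive vs f) x.

(** ** Smooth manifolds *)

(* [cmap] and [cinv] are total functions, meaningful only on [cdom] and on
   [cmap @` cdom] respectively. *)
Record chart (R : realType) (m : nat) (M : topologicalType) := Chart {
  cdom : set M ;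
  cmap :> M -> 'rV[R]_m ;
  cinv : 'rV[R]_m -> M ;
  cdom_open : open cdom ;
  cimg_open : open (cmap @` cdom) ;
  cmapK : forall z, cdom z -> cinv (cmap z) = z ;
  cmap_continuous : forall z, cdom z -> {for z, continuous cmap} ;
  cinv_continuous : forall x, (cmap @` cdom) x -> {for x, continuous cinv} }.

Definition cimg (R : realType) (m : nat) (M : topologicalType)
  (c : chart R m M) : set 'rV[R]_m := cmap c @` cdom c.

Record manifold (R : realType) (m : nat) (M : topologicalType) := Manifold {
  atlas : set (chart R m M) ;
  atlas_cover : forall z : M, exists2 c, atlas c & cdom c z ;
  atlas_compatible : forall c c', atlas c -> atlas c' ->
    smooth_on (c @` (cdom c `&` cdom c')) (c' \o cinv c) ;
  manifold_hausdorff : hausdorff_space M ;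
  manifold_second_countable : @second_countable M }.

(* Smoothness on the open subset U of a normed space V of a map V -> M. *)
Definition smooth_into (R : realType) (m : nat) (M : topologicalType)
    (AM : manifold R m M) (V : normedModType R) (U : set V) (f : V -> M) : Prop :=
  (forall x, U x -> {for x, continuous f}) /\
  (forall c, atlas AM c -> smooth_on (U `&` f @^-1` cdom c) (c \o f)).

Definition smooth_map (R : realType) (m n : nat) (M N : topologicalType)
    (AM : manifold R m M) (AN : manifold R n N) (f : M -> N) : Prop :=
  forall c, atlas AM c -> smooth_into AN (cimg c) (f \o cinv c).

Definition constant_rank (R : realType) (m n : nat) (M N : topologicalType)
    (AM : manifold R m M) (AN : manifold R n N) (f : M -> N) : Prop :=
  exists r : nat, forall (z : M) c c', atlas AM c -> cdom c z ->
    atlas AN c' -> cdom c' (f z) -> \rank ('J (c' \o f \o cinv c) (c z)) = r.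

(** ** Lie groups and smooth actions *)

#[short(type="topGroupType")]
HB.structure Definition TopGroup := {G of Topological G & Group G}.

Record lie_group (R : realType) (d : nat) (G : topGroupType) := LieGroup {
  lie_manifold :> manifold R d G ;
  lie_mul_smooth : forall a b, atlas lie_manifold a -> atlas lie_manifold b ->
    smooth_into lie_manifold (cimg a `*` cimg b)
      (fun xy : 'rV[R]_d * 'rV[R]_d => (cinv a xy.1 * cinv b xy.2)%g) ;
  lie_inv_smooth : forall a, atlas lie_manifold a ->
    smooth_into lie_manifold (cimg a) (fun x : 'rV[R]_d => ((cinv a x)^-1)%g) }.

Record lie_action (R : realType) (d m : nat) (G : topGroupType)
    (M : topologicalType) (LG : lie_group R d G) (AM : manifold R m M)
    (act : G -> M -> M) : Prop := LieAction {
  lie_act1 : forall z, act 1%g z = z ;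
  lie_actM : forall g h z, act (g * h)%g z = act g (act h z) ;
  lie_act_smooth : forall a c, atlas LG a -> atlas AM c ->
    smooth_into AM (cimg a `*` cimg c)
      (fun xy : 'rV[R]_d * 'rV[R]_m => act (cinv a xy.1) (cinv c xy.2)) }.

(** ** Projectable actions *)

Definition fiber (M N : Type) (Pi : M -> N) (v : N) : set M :=
  Pi @^-1` [set v].

Definition projectable (G : Type) (M N : Type) (Pi : M -> N)
    (act : G -> M -> M) : Prop :=
  forall (v : N) (g : G), exists w : N, act g @` fiber Pi v = fiber Pi w.

(* g . v is the (unique, Pi being onto) w with g . F_v = F_w. *)
Definition induced_act (G : Type) (M N : topologicalType) (Pi : M -> N)
    (act : G -> M -> M) (g : G) (v : N) : N :=
  xget v [set w | act g @` fiber Pi v = fiber Pi w].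

Definition global_isotropy (G : Type) (M N : topologicalType) (Pi : M -> N)
    (act : G -> M -> M) : set G :=
  [set g | forall v : N, induced_act Pi act g v = v].

(* The elements of [G] = G / G_N^* are the cosets of G_N^*. *)
Definition effective_group (G : topGroupType) (M N : topologicalType)
    (Pi : M -> N) (act : G -> M -> M) : set (set G) :=
  range (fun g : G => [set (g * h)%g | h in global_isotropy Pi act]).

Definition effective_act (G : topGroupType) (M N : topologicalType)
    (Pi : M -> N) (act : G -> M -> M) (C : set G) (v : N) : N :=
  xget v [set w | exists2 g : G, C g & w = induced_act Pi act g v].

(** ** Submanifolds *)

(* f restricts to a homeomorphism of A onto f(A), given that f is continuous. *)
Definition embeds (X Y : topologicalType) (f : X -> Y) (A : set X) : Prop :=
  set_inj A f /\
  (forall O, open O -> exists2 O', open O' & f @` (A `&` O) = f @` A `&` O').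

(* sigma restricts to a smooth parametrization (an immersion that is a
   homeomorphism onto its image) of an open neighborhood of z in S by an open
   neighborhood of 0 in R^p, with sigma 0 = z. *)
Definition local_param (R : realType) (m : nat) (M : topologicalType)
    (AM : manifold R m M) (p : nat) (S : set M) (z : M)
    (sigma : 'rV[R]_p -> M) : Prop :=
  sigma 0 = z /\
  exists (U : set 'rV[R]_p) (O : set M),
    [/\ open U /\ U 0, open O /\ sigma @` U = S `&` O,
        smooth_into AM U sigma, embeds sigma U &
        forall x c, U x -> atlas AM c -> cdom c (sigma x) ->
          injective ('d (c \o sigma) x)].

Definition submanifold (R : realType) (m : nat) (M : topologicalType)
    (AM : manifold R m M) (p : nat) (S : set M) : Prop :=
  forall z, S z -> exists sigma, local_param (p := p) AM S z sigma.

(* T_z S, expressed in the chart c around z. *)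
Definition tangent (R : realType) (m : nat) (M : topologicalType)
    (AM : manifold R m M) (p : nat) (S : set M) (z : M) (c : chart R m M) :
    set 'rV[R]_m :=
  [set w | exists (sigma : 'rV[R]_p -> M) (v : 'rV[R]_p),
     local_param AM S z sigma /\ w = 'd (c \o sigma) 0 v].

(* T_z S meets ker d(Pi)|_z trivially for all z in S. *)
Definition regular (R : realType) (m n : nat) (M N : topologicalType)
    (AM : manifold R m M) (AN : manifold R n N) (p : nat) (Pi : M -> N)
    (S : set M) : Prop :=
  forall z c c', S z -> atlas AM c -> cdom c z ->
    atlas AN c' -> cdom c' (Pi z) ->
    forall w, tangent AM p S z c w ->
      'd (c' \o Pi \o cinv c) (c z) w = 0 -> w = 0.

(** ** Jets of submanifolds *)

Definition multi_index (p k : nat) : finType :=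
  {J : {ffun 'I_p -> 'I_k.+1} | (\sum_i J i <= k)%N}.

Definition partial_derive (R : realType) (p k : nat) (W : normedModType R)
    (J : multi_index p k) (f : 'rV[R]_p -> W) : 'rV[R]_p -> W :=
  iter_derive (flatten [seq nseq (val J i) (delta_mx 0 i) | i <- enum 'I_p]) f.

(* The partial derivatives at 0, of all orders <= k, of sigma in the chart c. *)
Definition velocity (R : realType) (m : nat) (M : topologicalType)
    (p k : nat) (c : chart R m M) (sigma : 'rV[R]_p -> M) :
    'M[R]_(#|multi_index p k|, m) :=
  \matrix_(J, a) partial_derive (enum_val J) (c \o sigma) 0 0 a.

(* k-th order contact of S and S' at z: they have local parametrizations at z
   with the same derivatives of order <= k in coordinates. *)
Definition contact (R : realType) (m : nat) (M : topologicalType)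
    (AM : manifold R m M) (p k : nat) (z : M) (S S' : set M) : Prop :=
  exists sigma sigma' : 'rV[R]_p -> M,
    [/\ local_param AM S z sigma, local_param AM S' z sigma' &
        forall c, atlas AM c -> cdom c z ->
          velocity k c sigma = velocity k c sigma'].

(* A jet is an equivalence class of pairs (z, S), S a submanifold through z. *)
Definition jet_of (M : Type) : Type := set (M * set M).

Definition jet (R : realType) (m : nat) (M : topologicalType)
    (AM : manifold R m M) (p k : nat) (z : M) (S : set M) : jet_of M :=
  [set y | [/\ y.1 = z, submanifold AM p y.2 & contact AM p k z S y.2]].

Definition jets (R : realType) (m : nat) (M : topologicalType)
    (AM : manifold R m M) (p k : nat) : set (jet_of M) :=
  [set j | exists z S, [/\ submanifold AM p S, S z & j = jet AM p k z S]].

Definition regular_jets (R : realType) (m n : nat) (M N : topologicalType)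
    (AM : manifold R m M) (AN : manifold R n N) (p k : nat) (Pi : M -> N) :
    set (jet_of M) :=
  [set j | exists z S, [/\ submanifold AM p S, regular AM AN p Pi S, S z &
                           j = jet AM p k z S]].

(* The map Pi^(k), j_k S|_z |-> j_k Pi(S)|_(Pi z).  For a Pi-regular S the map
   Pi|_S is an immersion, hence an embedding once S is replaced by a small
   enough neighborhood of z in S, which does not change j_k S|_z; Pi(S) is
   understood for such an S. *)
Definition jet_projection (R : realType) (m n : nat) (M N : topologicalType)
    (AM : manifold R m M) (AN : manifold R n N) (p k : nat) (Pi : M -> N)
    (j : jet_of M) : jet_of N :=
  xget set0 [set j' | exists z S,
    [/\ submanifold AM p S /\ S z, regular AM AN p Pi S, embeds Pi S,
        j = jet AM p k z S & j' = jet AN p k (Pi z) (Pi @` S)]].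

(* The graph of the prolongation f^(k) of a diffeomorphism f,
   j_k S|_z |-> j_k f(S)|_(f z). *)
Definition prolongation (R : realType) (m : nat) (M : topologicalType)
    (AM : manifold R m M) (p k : nat) (f : M -> M) (j j' : jet_of M) : Prop :=
  exists z S, [/\ submanifold AM p S /\ S z, submanifold AM p (f @` S),
    j = jet AM p k z S & j' = jet AM p k (f z) (f @` S)].

(** ** Differential functions and invariants *)

(* The jet bundle carries the smooth structure of the quotient of the manifold
   of k-jets at 0 of immersions sigma : R^p -> M by changes of parameter, the
   quotient map sending the k-jet of sigma to the k-jet of the submanifold it
   parametrizes.  In a chart c of M, a k-jet of immersion is given by its
   partial derivatives [velocity k c sigma]; [jet_velocity c w j] means that
   those with coordinates w are sent to j. *)
Definition jet_velocity (R : realType) (m : nat) (M : topologicalType)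
    (AM : manifold R m M) (p k : nat) (c : chart R m M)
    (w : 'M[R]_(#|multi_index p k|, m)) (j : jet_of M) : Prop :=
  exists z S sigma, [/\ cdom c z, submanifold AM p S,
    local_param AM S z sigma, w = velocity k c sigma & j = jet AM p k z S].

Definition jet_coords (R : realType) (m : nat) (M : topologicalType)
    (AM : manifold R m M) (p k : nat) (c : chart R m M) (D : set (jet_of M)) :
    set 'M[R]_(#|multi_index p k|, m) :=
  [set w | exists2 j, D j & jet_velocity AM c w j].

Definition jet_open (R : realType) (m : nat) (M : topologicalType)
    (AM : manifold R m M) (p k : nat) (D : set (jet_of M)) : Prop :=
  D `<=` jets AM p k /\
  (forall c, atlas AM c -> open (jet_coords AM (p := p) (k := k) c D)).

(* A differential function of order k with domain D; the values of F outside D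
   are irrelevant. *)
Definition differential_function (R : realType) (m : nat) (M : topologicalType)
    (AM : manifold R m M) (p k : nat) (D : set (jet_of M)) (F : jet_of M -> R) :
    Prop :=
  jet_open AM p k D /\
  (forall c, atlas AM c ->
     exists2 f : 'M[R]_(#|multi_index p k|, m) -> R^o,
       smooth_on (jet_coords AM c D) f &
       forall w j, D j -> jet_velocity AM c w j -> f w = F j).

(* The group is given as a set T of elements of a type X acting by a. *)
Definition differential_invariant (R : realType) (m : nat) (M : topologicalType)
    (AM : manifold R m M) (p k : nat) (X : Type) (T : set X) (a : X -> M -> M)
    (D : set (jet_of M)) (F : jet_of M -> R) : Prop :=
  differential_function AM p k D F /\
  (forall t j j', T t -> prolongation AM p k (a t) j j' ->
     D j -> D j' -> F j' = F j).

(* Main.v *)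
(* If sigma parametrizes a Pi-regular submanifold S near z then Pi o sigma
   parametrizes Pi(S), and by the chain rule its k-jet depends only on that of
   sigma; so Pi^(k) is well defined on jets.  Two parametrizations of the same
   submanifold differ by a smooth change of parameter, which makes contact an
   equivalence relation.  Adding to sigma, in a chart, the polynomial with a
   prescribed small k-jet gives regular submanifolds realizing all nearby
   velocities; hence the regular jets form an open set, and Pi^(k) is smooth in
   coordinates, which gives the domain and the smoothness of I o Pi^(k).
   For the invariance, g . Pi(z) = Pi(g . z), so g maps Pi(S) to Pi(g . S); if
   the jets of S and g . S are regular, small pieces of both sets are
   submanifolds of N, and Pi^(k) intertwines the prolonged actions. *)

Require Import Defs.
From HB Require Import structures.
From mathcomp Require Import all_boot all_order all_algebra.
From mathcomp Require Import ring lra.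
From mathcomp Require Import all_classical all_reals all_analysis.
Set Implicit Arguments.
Unset Strict Implicit.
Unset Printing Implicit Defensive.
Import Order.TTheory GRing.Theory Num.Theory.
Import numFieldNormedType.Exports.
Local Open Scope classical_set_scope.
Local Open Scope ring_scope.

(** * Pointwise smoothness *)

Section Differentiability.
Variable R : realType.
Implicit Types V W X : normedModType R.

(** No existence part of the inverse function theorem enters. An embedded parametrization already
    has a continuous local inverse, so only the smoothness of that inverse is at stake, and it
    follows by bootstrapping on the formula for its derivative. Conversely, the embeddings to be
    constructed come from the mean value theorem: a map with Jacobian 1 at a point shrinks distances
    near it by a factor 2 at most. A jet is a set of representatives, and [jet_projection] computes
    through one on which [Pi] is an embedding. Every argument on jets therefore passes to small
    patches with this property; for the invariance, one patch must serve for [S] and its image for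
    [g . S] at the same time. For [k = 0] this is a real constraint: the jet forgets the tangent
    plane, so its regularity says nothing about the given [S]. A plane that is transverse to the
    fibers at [z], and whose image under [g] is transverse at [g . z], is then found by genericity:
    two determinants, polynomial along a segment of planes and not identically zero, have a common
    point of nonvanishing. *)

Lemma differentiable_bound V W (f : V -> W) (x : V) :
  differentiable f x -> forall e, 0 < e ->
  \forall y \near x, `|f y - f x - 'd f x (y - x)| <= e * `|y - x|.
Proof.
move=> df e e0.
have /eqaddoP/(_ e e0) := diff_locally df.
rewrite (near_shift 0 x) subr0 => H; apply: filterS H => y /=.
by rewrite !fctE /= addrK opprD addrA.
Qed.

Lemma differentiableI V W (f : V -> W) (x : V) (L : {linear V -> W}) :
  continuous L ->
  (forall e, 0 < e -> \forall y \near x,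
     `|f y - f x - L (y - x)| <= e * `|y - x|) ->
  differentiable f x /\ 'd f x = L :> (V -> W).
Proof.
move=> cL H.
have E : f \o shift x = cst (f x) + L +o_ 0 id.
  apply/eqaddoP => e e0; have := H e e0.
  rewrite (near_shift 0 x) subr0 => {}H; apply: filterS H => y /=.
  by rewrite !fctE /= addrK opprD addrA.
have dE : 'd f x = L :> (V -> W) by apply: diff_unique.
by split=> //; apply/diff_locallyP; rewrite dE.
Qed.

Lemma near_differentiable V W (f g : V -> W) (x : V) :
  {near x, f =1 g} -> differentiable f x -> differentiable g x.
Proof.
move=> fg df.
apply: (proj1 (differentiableI (L := 'd f x) _ _)).
  exact: diff_continuous.
move=> e e0; rewrite -(nbhs_singleton fg).
by apply: filterS2 fg (differentiable_bound df e0) => y <-.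
Qed.

Lemma near_derive V W (f g : V -> W) (x v : V) :
  {near x, f =1 g} -> {near x, 'D_v f =1 'D_v g}.
Proof. by move=> /near_join fg; apply: filterS fg => y; exact: near_eq_derive. Qed.

(* The neighbourhood of [x] may depend on [r] and on the directions chosen so
   far; on an open set [forall x, smooth_at f x] is still [smooth_on]. *)
Fixpoint ndiff V W (r : nat) (f : V -> W) (x : V) : Prop :=
  (\forall y \near x, differentiable f y) /\
  (if r is r'.+1 then forall v, ndiff r' ('D_v f) x else True).

Definition smooth_at V W (f : V -> W) (x : V) := forall r, ndiff r f x.

Lemma ndiff_diff V W r (f : V -> W) x :
  ndiff r f x -> \forall y \near x, differentiable f y.
Proof. by case: r => [|r] []. Qed.

Lemma ndiffS V W r (f : V -> W) x : ndiff r.+1 f x -> ndiff r f x.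
Proof.
elim: r f => [|r IH] f [df H]; split=> // v.
by apply: IH; exact: H.
Qed.

Lemma near_ndiff V W r (f g : V -> W) (x : V) :
  {near x, f =1 g} -> ndiff r f x -> ndiff r g x.
Proof.
elim: r f g => [|r IH] f g fg [df H]; split=> //.
- have /near_join fg' := fg; apply: filterS2 fg' df => y.
  exact: near_differentiable.
- have /near_join fg' := fg; apply: filterS2 fg' df => y.
  exact: near_differentiable.
- by move=> v; apply: IH (H v); exact: near_derive.
Qed.

Lemma smooth_at_near V W (f g : V -> W) (x : V) :
  {near x, f =1 g} -> smooth_at f x -> smooth_at g x.
Proof. by move=> fg sf r; apply: near_ndiff (sf r). Qed.

Lemma smooth_at_differentiable V W (f : V -> W) x :
  smooth_at f x -> differentiable f x.
Proof. by move=> /(_ 0%N)/ndiff_diff/nbhs_singleton. Qed.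

Lemma smooth_at_continuous V W (f : V -> W) x :
  smooth_at f x -> {for x, continuous f}.
Proof. by move=> /smooth_at_differentiable/differentiable_continuous. Qed.

Lemma smooth_at_derive V W (f : V -> W) x v :
  smooth_at f x -> smooth_at ('D_v f) x.
Proof. by move=> sf r; have [_ H] := sf r.+1; exact: H. Qed.

(** The head of [vs] is the outermost derivative, whereas [ndiff] and [agree] peel off the innermost
    one; inductions on the directions therefore go through [rcons]. *)
Lemma iter_derive_rcons V W (vs : seq V) v (f : V -> W) :
  iter_derive (rcons vs v) f = iter_derive vs ('D_v f).
Proof. by rewrite /iter_derive foldr_rcons. Qed.

Lemma smooth_onP V W (U : set V) (f : V -> W) : open U ->
  smooth_on U f <-> (forall x, U x -> smooth_at f x).
Proof.
move=> oU; split=> [sf x Ux r|sf vs x Ux].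
  elim: r f sf => [|r IH] f sf; split=> //.
  - by apply: filterS (open_nbhs_nbhs (conj oU Ux)) => y /(sf [::]).
  - by apply: filterS (open_nbhs_nbhs (conj oU Ux)) => y /(sf [::]).
  - by move=> v; apply: IH => vs y Uy; rewrite -iter_derive_rcons; exact: sf.
have := sf x Ux; elim/last_ind: vs f {sf} => [|vs v IH] f sf.
  exact: smooth_at_differentiable.
by rewrite iter_derive_rcons; apply: IH; exact: smooth_at_derive.
Qed.

Lemma near_iter_derive V W (vs : seq V) (f g : V -> W) (x : V) :
  {near x, f =1 g} -> {near x, iter_derive vs f =1 iter_derive vs g}.
Proof. by move=> fg; elim: vs => //= v vs IH; exact: (near_derive v IH). Qed.

Lemma ndiff_cst V W r (w : W) x : ndiff r (cst w : V -> W) x.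
Proof.
elim: r w => [|r IH] w; split=> //; try by apply: nearW => y; exact: differentiable_cst.
move=> v; suff -> : 'D_v (cst w : V -> W) = cst 0 by [].
by apply/funext => y; rewrite derive_cst.
Qed.

Lemma smooth_at_cst V W (w : W) x : smooth_at (cst w : V -> W) x.
Proof. by move=> r; exact: ndiff_cst. Qed.

Lemma ndiffD V W r (f g : V -> W) x :
  ndiff r f x -> ndiff r g x -> ndiff r (fun y => f y + g y) x.
Proof.
elim: r f g => [|r IH] f g [df Hf] [dg Hg]; split=> //;
  try by apply: filterS2 df dg => y; exact: differentiableD.
move=> v; apply: near_ndiff (IH _ _ (Hf v) (Hg v)).
apply: filterS2 df dg => y fy gy.
by rewrite -[RHS]/('D_v (f + g) y) deriveD //; exact: diff_derivable.
Qed.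

Lemma smooth_atD V W (f g : V -> W) x :
  smooth_at f x -> smooth_at g x -> smooth_at (fun y => f y + g y) x.
Proof. by move=> sf sg r; apply: ndiffD. Qed.

Lemma derive_linear_comp V W X (L : {linear W -> X}) (f : V -> W) x v :
  continuous L -> differentiable f x -> 'D_v (L \o f) x = L ('D_v f x).
Proof.
move=> cL df; have dL := linear_differentiable (f x) cL.
rewrite !deriveE //; last exact: differentiable_comp.
by rewrite diff_comp //= diff_lin.
Qed.

Lemma ndiff_linear_comp V W X r (L : {linear W -> X}) (f : V -> W) x :
  continuous L -> ndiff r f x -> ndiff r (L \o f) x.
Proof.
move=> cL; elim: r f => [|r IH] f [df H]; split=> //;
  try by apply: filterS df => y dy; apply: differentiable_comp dy _;
     exact: linear_differentiable.
move=> v; apply: near_ndiff (IH _ (H v)); apply: filterS df => y dy.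
by rewrite derive_linear_comp.
Qed.

Lemma smooth_at_linear_comp V W X (L : {linear W -> X}) (f : V -> W) x :
  continuous L -> smooth_at f x -> smooth_at (L \o f) x.
Proof. by move=> cL sf r; apply: ndiff_linear_comp. Qed.

Lemma smooth_at_id V (x : V) : smooth_at id x.
Proof.
case=> [|r]; split=> //; try by apply: nearW => y; exact: ex_diff.
move=> v; suff -> : 'D_v (id : V -> V) = cst v by exact: ndiff_cst.
by apply/funext => y; rewrite derive_id.
Qed.

Lemma smooth_at_linear V W (L : {linear V -> W}) x : continuous L -> smooth_at L x.
Proof. by move=> cL; exact: (smooth_at_linear_comp cL (smooth_at_id x)). Qed.

Lemma derive_affine V W X (L : {linear V -> W}) (a : W) (g : W -> X) x v :
  continuous L -> differentiable g (a + L x) ->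
  'D_v (fun y => g (a + L y)) x = 'D_(L v) g (a + L x).
Proof.
move=> cL dg.
have dA : is_diff x (fun y => a + L y) L.
  have dL : is_diff x L L.
    by apply: DiffDef; [exact: linear_differentiable|exact: diff_lin].
  by have := is_diffD (is_diff_cst a x) dL; rewrite add0r.
rewrite -[fun y => g _]/(g \o (fun y => a + L y)) !deriveE //; last first.
  by apply: differentiable_comp; first exact: ex_diff.
by rewrite diff_comp //= diff_val.
Qed.

(** The general chain rule [ndiff_comp] expands along a matrix basis of the intermediate space. The
    affine case allows any normed space there, such as the products on which group actions and
    deformations live. *)
Lemma ndiff_affine V W X r (L : {linear V -> W}) (a : W) (g : W -> X) x :
  continuous L -> ndiff r g (a + L x) -> ndiff r (fun y => g (a + L y)) x.
Proof.
move=> cL.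
have cA : (fun y => a + L y) y @[y --> x] --> a + L x.
  by apply: cvgD; [exact: cvg_cst | exact: cL].
have dA y : differentiable (fun y => a + L y) y.
  by apply: differentiableD; [exact: differentiable_cst|exact: linear_differentiable].
have dC (h : W -> X) : (\forall y \near a + L x, differentiable h y) ->
    \forall y \near x, differentiable (fun y => h (a + L y)) y.
  move=> dh; have H : \forall y \near x, differentiable h (a + L y) := cA _ dh.
  apply: filterS H => y dy.
  exact: (differentiable_comp (g := h) (dA y) dy).
elim: r g => [|r IH] g [dg H]; split=> //; try exact: dC.
move=> v; apply: near_ndiff (IH _ (H (L v))).
have {}H : \forall y \near x, differentiable g (a + L y) := cA _ dg.
by apply: filterS H => y dy; rewrite derive_affine.
Qed.

Lemma smooth_at_affine V W X (L : {linear V -> W}) (a : W) (g : W -> X) x :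
  continuous L -> smooth_at g (a + L x) -> smooth_at (fun y => g (a + L y)) x.
Proof. by move=> cL sg r; apply: ndiff_affine. Qed.

Lemma ndiffM V r (f g : V -> R) x :
  ndiff r f x -> ndiff r g x -> ndiff r (fun y => f y * g y) x.
Proof.
elim: r f g => [|r IH] f g nf ng; have [[df Hf] [dg Hg]] := (nf, ng);
  split=> //; try by apply: filterS2 df dg => y; exact: differentiableM.
move=> v; apply: near_ndiff (ndiffD (IH _ _ (ndiffS nf) (Hg v))
                                   (IH _ _ (ndiffS ng) (Hf v))).
apply: filterS2 df dg => y fy gy.
by rewrite -[RHS]/('D_v (f * g) y) deriveM //; exact: diff_derivable.
Qed.

Lemma smooth_atM V (f g : V -> R) x :
  smooth_at f x -> smooth_at g x -> smooth_at (fun y => f y * g y) x.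
Proof. by move=> sf sg r; apply: ndiffM. Qed.

Lemma ndiffV V r (f : V -> R) x :
  f x != 0 -> ndiff r f x -> ndiff r (fun y => (f y)^-1) x.
Proof.
move=> fx0; elim: r f fx0 => [|r IH] f fx0 nf.
  have [df Hf] := nf; have cf := differentiable_continuous (nbhs_singleton df).
  have f0 : \forall y \near x, f y != 0.
    by apply: (cf [set u | u != 0]); apply: open_nbhs_nbhs; split=> //; exact: open_neq.
  by split=> //; apply: filterS2 f0 df => y y0 dy; exact: differentiableV.
have [df Hf] := nf; have cf := differentiable_continuous (nbhs_singleton df).
have f0 : \forall y \near x, f y != 0.
  by apply: (cf [set u | u != 0]); apply: open_nbhs_nbhs; split=> //; exact: open_neq.
split; first by apply: filterS2 f0 df => y y0 dy; exact: differentiableV.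
move=> v.
have nI := IH _ fx0 (ndiffS nf).
(* The derivative of [1 / f] is [- f^-2 * 'D_v f], a product of functions already known to be of
   order [r]. *)
have := ndiffM (ndiffM (ndiffM nI nI) (Hf v)) (@ndiff_cst V _ r (-1 : R) x).
apply: near_ndiff.
apply: filterS2 f0 df => y y0 dy /=.
rewrite [RHS]deriveE ?diffV //; last exact: differentiableV.
by rewrite /= -deriveE // /GRing.scale /= mulrN1 expr2 invfM mulNr.
Qed.

Lemma smooth_atV V (f : V -> R) x :
  f x != 0 -> smooth_at f x -> smooth_at (fun y => (f y)^-1) x.
Proof. by move=> fx sf r; apply: ndiffV. Qed.

Lemma ndiff_sum V W (I : Type) (s : seq I) (P : pred I) (F : I -> V -> W) r x :
  (forall i, P i -> ndiff r (F i) x) -> ndiff r (fun y => \sum_(i <- s | P i) F i y) x.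
Proof.
move=> sF; elim: s => [|i s IH].
  have -> : (fun y => \sum_(i <- [::] | P i) F i y) = cst 0.
    by apply/funext => y; rewrite big_nil.
  exact: ndiff_cst.
have -> : (fun y => \sum_(j <- i :: s | P j) F j y) =
    if P i then fun y => F i y + \sum_(j <- s | P j) F j y
    else fun y => \sum_(j <- s | P j) F j y.
  by case: ifP => Pi; apply/funext => y; rewrite big_cons Pi.
by case: ifP => // Pi; apply: ndiffD IH; exact: sF.
Qed.

Lemma smooth_at_sum V W (I : Type) (s : seq I) (P : pred I) (F : I -> V -> W) x :
  (forall i, P i -> smooth_at (F i) x) ->
  smooth_at (fun y => \sum_(i <- s | P i) F i y) x.
Proof. by move=> sF r; apply: ndiff_sum => i Pi; exact: sF. Qed.

Lemma smooth_at_prod V (I : Type) (s : seq I) (P : pred I) (F : I -> V -> R) x :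
  (forall i, P i -> smooth_at (F i) x) ->
  smooth_at (fun y => \prod_(i <- s | P i) F i y) x.
Proof.
move=> sF; elim: s => [|i s IH].
  have -> : (fun y => \prod_(i <- [::] | P i) F i y) = cst 1.
    by apply/funext => y; rewrite big_nil.
  exact: smooth_at_cst.
have -> : (fun y => \prod_(j <- i :: s | P j) F j y) =
    if P i then fun y => F i y * \prod_(j <- s | P j) F j y
    else fun y => \prod_(j <- s | P j) F j y.
  by case: ifP => Pi; apply/funext => y; rewrite big_cons Pi.
by case: ifP => // Pi; apply: smooth_atM IH; exact: sF.
Qed.

End Differentiability.

(** * Matrix-valued maps: chain rule, products, determinants and inverses *)

Section MatrixValued.
Variable R : realType.
Implicit Types V W X : normedModType R.

(** A named coordinate function, to carry the linear structure that [ndiff_linear_comp] asks for;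
    [R^o] is the field as a module over itself. *)
Definition mxentry m n (i : 'I_m) (j : 'I_n) (A : 'M[R]_(m, n)) : R := A i j.

Lemma mxentry_is_linear m n i j : linear (@mxentry m n i j : _ -> R^o).
Proof. by move=> a A B; rewrite /mxentry !mxE. Qed.

HB.instance Definition _ m n i j := GRing.isLinear.Build R 'M[R]_(m, n) R^o _
  (@mxentry m n i j) (@mxentry_is_linear m n i j).

Lemma mxentry_continuous m n i j : continuous (@mxentry m n i j).
Proof. exact: coord_continuous. Qed.

Lemma ndiff_entry V m n r (f : V -> 'M[R]_(m, n)) x i j :
  ndiff r f x -> ndiff r (fun y => f y i j : R) x.
Proof.
exact: (@ndiff_linear_comp R V _ R^o r (mxentry i j) f x (@mxentry_continuous m n i j)).
Qed.

Lemma smooth_at_entry V m n (f : V -> 'M[R]_(m, n)) x i j :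
  smooth_at f x -> smooth_at (fun y => f y i j : R) x.
Proof. by move=> sf r; exact: ndiff_entry. Qed.

Lemma ndiffZl V W r (a : V -> R) (w : W) x :
  ndiff r a x -> ndiff r (fun y => a y *: w) x.
Proof.
have sx_lin : linear ( *:%R ^~ w : R^o -> W).
  by move=> u y z; rewrite scalerDl scalerA.
pose sxlM := GRing.isLinear.Build _ _ _ _ _ sx_lin.
pose sxL : {linear R^o -> W} := HB.pack ( *:%R ^~ w) sxlM.
apply: (@ndiff_linear_comp R V R^o W r sxL a x).
exact: (@scalel_continuous R W w).
Qed.

Lemma smooth_atZl V W (a : V -> R) (w : W) x :
  smooth_at a x -> smooth_at (fun y => a y *: w) x.
Proof. by move=> sa r; exact: ndiffZl. Qed.

Lemma ndiff_mx V m n r (f : V -> 'M[R]_(m, n)) x :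
  (forall i j, ndiff r (fun y => f y i j : R) x) -> ndiff r f x.
Proof.
move=> H.
have -> : f = fun y => \sum_i \sum_j f y i j *: delta_mx i j.
  by apply/funext => y; exact: matrix_sum_delta.
apply: ndiff_sum => i _; apply: ndiff_sum => j _; exact: ndiffZl.
Qed.

Lemma smooth_at_mx V m n (f : V -> 'M[R]_(m, n)) x :
  (forall i j, smooth_at (fun y => f y i j : R) x) -> smooth_at f x.
Proof. by move=> H r; apply: ndiff_mx => i j; exact: H. Qed.

(** Expanded on the matrix basis, [L] is a finite sum of entries times fixed vectors, hence smooth
    and in particular continuous. *)
Lemma linear_mx_continuous m n W (L : {linear 'M[R]_(m, n) -> W}) : continuous L.
Proof.
move=> x; apply: smooth_at_continuous => r.
have -> : (L : _ -> _) = fun y : 'M[R]_(m, n) => \sum_i \sum_j y i j *: L (delta_mx i j).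
  apply/funext => y; rewrite {1}[y]matrix_sum_delta linear_sum.
  by apply: eq_bigr => i _; rewrite linear_sum; apply: eq_bigr => j _; rewrite linearZ.
apply: ndiff_sum => i _; apply: ndiff_sum => j _; apply: ndiffZl.
exact: (ndiff_entry _ _ (smooth_at_id x r)).
Qed.

Lemma derive_comp_mx V W m n (g : 'M[R]_(m, n) -> W) (f : V -> 'M[R]_(m, n)) x v :
  differentiable f x -> differentiable g (f x) ->
  'D_v (g \o f) x = \sum_i \sum_j 'D_v f x i j *: 'D_(delta_mx i j) g (f x).
Proof.
move=> df dg; rewrite deriveE; last exact: differentiable_comp.
rewrite diff_comp //= -(deriveE v df) {1}['D_v f x]matrix_sum_delta linear_sum.
apply: eq_bigr => i _; rewrite linear_sum; apply: eq_bigr => j _.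
by rewrite linearZ -deriveE.
Qed.

Lemma ndiff_comp_real V m n r (g : 'M[R]_(m, n) -> R) (f : V -> 'M[R]_(m, n)) x :
  ndiff r f x -> ndiff r g (f x) -> ndiff r (g \o f) x.
Proof.
have dC (h : 'M[R]_(m, n) -> R) : {for x, continuous f} ->
  (\forall y \near f x, differentiable h y) -> \forall y \near x, differentiable h (f y).
  by move=> cf dh; exact: (cf _ dh).
elim: r g => [|r IH] g nf [dg Hg]; have [df Hf] := nf;
  have cf := differentiable_continuous (nbhs_singleton df); have dgf := dC _ cf dg;
  (split=> //; first by apply: filterS2 df dgf => y; exact: differentiable_comp).
move=> v.
(* By the chain rule the derivative is a sum of products whose second factor is again a composite,
   with a derivative of [g] in place of [g]; [f] is lowered by one order to match. *)
have : ndiff r (fun y => \sum_i \sum_j 'D_v f y i j * 'D_(delta_mx i j) g (f y)) x.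
  apply: ndiff_sum => i _; apply: ndiff_sum => j _.
  by apply: ndiffM; [exact: ndiff_entry (Hf v) | exact: IH (ndiffS nf) (Hg _)].
apply: near_ndiff; apply: filterS2 df dgf => y dfy dgy.
by rewrite derive_comp_mx.
Qed.

Lemma smooth_at_comp_real V m n (g : 'M[R]_(m, n) -> R) (f : V -> 'M[R]_(m, n)) x :
  smooth_at f x -> smooth_at g (f x) -> smooth_at (g \o f) x.
Proof. by move=> sf sg r; apply: ndiff_comp_real. Qed.

Lemma ndiff_comp V m n m' n' r (g : 'M[R]_(m, n) -> 'M[R]_(m', n'))
    (f : V -> 'M[R]_(m, n)) x :
  ndiff r f x -> ndiff r g (f x) -> ndiff r (g \o f) x.
Proof.
move=> nf ng; apply: ndiff_mx => i j.
by apply: (ndiff_comp_real (g := fun y => g y i j) nf); exact: ndiff_entry.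
Qed.

Lemma smooth_at_comp V m n m' n' (g : 'M[R]_(m, n) -> 'M[R]_(m', n'))
    (f : V -> 'M[R]_(m, n)) x :
  smooth_at f x -> smooth_at g (f x) -> smooth_at (g \o f) x.
Proof. by move=> sf sg r; apply: ndiff_comp. Qed.

Lemma ndiff_mulmx V m n k r (f : V -> 'M[R]_(m, n)) (g : V -> 'M[R]_(n, k)) x :
  ndiff r f x -> ndiff r g x -> ndiff r (fun y => f y *m g y) x.
Proof.
move=> sf sg; apply: ndiff_mx => i j.
have -> : (fun y => (f y *m g y) i j) = fun y => \sum_l f y i l * g y l j.
  by apply/funext => y; rewrite mxE.
by apply: ndiff_sum => l _; apply: ndiffM; exact: ndiff_entry.
Qed.

Lemma smooth_at_mulmx V m n k (f : V -> 'M[R]_(m, n)) (g : V -> 'M[R]_(n, k)) x :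
  smooth_at f x -> smooth_at g x -> smooth_at (fun y => f y *m g y) x.
Proof. by move=> sf sg r; apply: ndiff_mulmx. Qed.

Lemma smooth_at_det V n (f : V -> 'M[R]_n) x :
  (forall i j, smooth_at (fun y => f y i j : R) x) ->
  smooth_at (fun y => \det (f y) : R) x.
Proof.
move=> sf.
rewrite /determinant.
apply: smooth_at_sum => s _; apply: smooth_atM; first exact: smooth_at_cst.
by apply: smooth_at_prod.
Qed.

(** Stated for the cofactor formula, an explicit rational function of the entries; [invmx] agrees
    with it wherever the matrix is invertible. *)
Lemma smooth_at_invmx V n (f : V -> 'M[R]_n) x :
  \det (f x) != 0 -> smooth_at f x ->
  smooth_at (fun y => (\det (f y))^-1 *: \adj (f y)) x.
Proof.
move=> fx sf.
have sd : smooth_at (fun y => \det (f y) : R) x.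
  by apply: smooth_at_det => i j; exact: smooth_at_entry.
apply: smooth_at_mx => i j.
have -> : (fun y => ((\det (f y))^-1 *: \adj (f y)) i j) =
  fun y => (\det (f y))^-1 * ((-1) ^+ (j + i) * \det (row' j (col' i (f y)))).
  by apply/funext => y; rewrite !mxE.
apply: smooth_atM; first exact: smooth_atV.
apply: smooth_atM; first exact: smooth_at_cst.
apply: smooth_at_det => a b.
have -> : (fun y => row' j (col' i (f y)) a b) = fun y => f y (lift j a) (lift i b).
  by apply/funext => y; rewrite !mxE.
exact: smooth_at_entry.
Qed.

End MatrixValued.

(** * Symmetry of second derivatives *)

Section Schwarz.
Variable R : realType.
Implicit Types V W : normedModType R.

Lemma is_derive_line V W (f : V -> W) (a u : V) (s : R) :
  differentiable f (a + s *: u) ->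
  is_derive s (1 : R) (fun t : R => f (a + t *: u)) ('D_u f (a + s *: u)).
Proof.
move=> df.
have dA : is_diff s (fun t : R => a + t *: u) ( *:%R^~ u).
  by have := is_diffD (is_diff_cst a s) (is_diff_scalel s u); rewrite add0r.
have dc : differentiable (f \o (fun t : R => a + t *: u)) s.
  by apply: differentiable_comp; first exact: ex_diff.
apply: DeriveDef; first exact: diff_derivable.
rewrite -[fun t => f _]/(f \o (fun t : R => a + t *: u)) deriveE //.
by rewrite diff_comp //= ?diff_val ?scale1r ?deriveE //; exact: ex_diff.
Qed.

(* One mean value step, followed by the differentiability of ['D_u f] at [x],
   so that continuity of the second derivative is not needed. *)
Lemma second_difference V (f : V -> R) (x u v : V) (e : R) : 0 < e ->
  (\forall y \near x, differentiable f y) -> differentiable ('D_u f) x ->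
  exists2 d : R, 0 < d & forall t, 0 < t < d ->
    `|f (x + t *: u + t *: v) - f (x + t *: u) - f (x + t *: v) + f x
      - t ^+ 2 * 'D_v ('D_u f) x| <= e * t ^+ 2.
Proof.
(* [M] keeps both edges within [t * M] of [x]; each of the two error terms is then at most
   [e / (2 * M) * (t * M)], that is, half of [e * t]. *)
move=> e0 df dG; set M := `|u| + `|v| + 1.
have M0 : 0 < M by rewrite ltr_wpDl // addr_ge0.
have e'0 : 0 < e / (2 * M) by rewrite divr_gt0 // mulr_gt0.
have nA : nbhs x [set y | differentiable f y /\
    `|'D_u f y - 'D_u f x - 'd ('D_u f) x (y - x)| <= e / (2 * M) * `|y - x|].
  exact: filterI df (differentiable_bound dG e'0).
have [r /= r0 Hr0] := (nbhs_ballP _ _).1 nA.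
have Hr y : `|y - x| < r -> differentiable f y /\
    `|'D_u f y - 'D_u f x - 'd ('D_u f) x (y - x)| <= e / (2 * M) * `|y - x|.
  by move=> yx; apply: Hr0; rewrite -ball_normE /= distrC.
exists (r / M); first exact: divr_gt0.
move=> t /andP[t0 td].
have tM : t * M < r by rewrite -ltr_pdivlMr.
have small (c : R) : 0 <= c <= t -> forall b : bool,
    `|(x + (b%:R * t) *: v + c *: u) - x| <= t * M.
  move=> /andP[c0 ct] b; rewrite -[x + _ + _]addrA [x + _]addrC addrK.
  apply: le_trans (ler_normD _ _) _; rewrite normrZ [in X in _ + X]normrZ (ger0_norm c0).
  have h1 : c * `|u| <= t * `|u| by exact: ler_wpM2r.
  have h2 : `|b%:R * t| * `|v| <= t * `|v|.
    apply: ler_wpM2r => //; rewrite ger0_norm; last by rewrite mulr_ge0 // ?ler0n // ltW.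
    by case: b; rewrite ?mul1r ?mul0r // ltW.
  apply: le_trans (lerD h2 h1) _; by rewrite /M 2!mulrDr [t * `|u| + _]addrC lerDl mulr1 ltW.
(* The second difference is [phi t - phi 0], and [dphi] compares ['D_u f] on two parallel edges,
   where its linear approximation at [x] leaves [t * 'D_v ('D_u f) x]. *)
pose phi s : R := f (x + t *: v + s *: u) - f (x + s *: u).
pose dphi s : R := 'D_u f (x + t *: v + s *: u) - 'D_u f (x + s *: u).
have sm1 c : 0 <= c <= t -> `|(x + t *: v + c *: u) - x| <= t * M.
  by move=> hc; have := small c hc true; rewrite mul1r.
have sm0 c : 0 <= c <= t -> `|(x + c *: u) - x| <= t * M.
  by move=> hc; have := small c hc false; rewrite mul0r scale0r addr0.
have dp s : 0 <= s <= t -> is_derive s (1 : R) phi (dphi s).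
  move=> hs; apply: is_deriveB; apply: is_derive_line.
    by have [] := Hr _ (le_lt_trans (sm1 _ hs) tM).
  by have [] := Hr _ (le_lt_trans (sm0 _ hs) tM).
have [||c hc Ec] := @MVT_segment R phi dphi 0 t (ltW t0).
- by move=> s; rewrite in_itv /= => /andP[s0 st]; apply: dp; rewrite !ltW.
- apply: derivable_within_continuous => s; rewrite in_itv /= => hs.
  by case: (dp s hs).
move: hc; rewrite in_itv /= => hc.
have [_ b1] := Hr _ (le_lt_trans (sm1 _ hc) tM).
have [_ b0] := Hr _ (le_lt_trans (sm0 _ hc) tM).
have -> : f (x + t *: u + t *: v) - f (x + t *: u) - f (x + t *: v) + f x =
    t * dphi c.
  move: Ec; rewrite subr0 /phi !scale0r !addr0 mulrC => <-.
  by rewrite addrAC [x + t *: u + _]addrAC opprB !addrA.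
have -> : t * dphi c - t ^+ 2 * 'D_v ('D_u f) x = t *
   (('D_u f (x + t *: v + c *: u) - 'D_u f x - 'd ('D_u f) x (x + t *: v + c *: u - x))
   - ('D_u f (x + c *: u) - 'D_u f x - 'd ('D_u f) x (x + c *: u - x))).
  rewrite expr2 -mulrA -mulrBr; congr (_ * _).
  rewrite (deriveE v dG) /dphi.
  have -> : x + t *: v + c *: u - x = t *: v + (x + c *: u - x).
    by rewrite -!addrA addrCA.
  have dZ : 'd ('D_u f) x (t *: v) = t * 'd ('D_u f) x v by rewrite linearZ.
  by rewrite linearD dZ; ring.
rewrite normrM (gtr0_norm t0) expr2 mulrCA ler_pM2l //.
rewrite (le_trans (ler_normB _ _)) //.
have -> : e * t = e / (2 * M) * (t * M) + e / (2 * M) * (t * M).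
  by rewrite -mulr2n -mulr_natr; field; rewrite gt_eqF.
have e'ge := ltW e'0.
by apply: lerD; [apply: le_trans b1 _|apply: le_trans b0 _]; rewrite ler_wpM2l // ?sm1 ?sm0.
Qed.

(** The second difference is symmetric in [u] and [v], and both mixed derivatives times [t ^+ 2]
    approximate it up to [e / 2 * t ^+ 2]; divide by [t ^+ 2], with [e] arbitrary. *)
Lemma derive_swap_real V (f : V -> R) (x u v : V) :
  ndiff 1 f x -> 'D_u ('D_v f) x = 'D_v ('D_u f) x.
Proof.
move=> [df H].
have dG w : differentiable ('D_w f) x := nbhs_singleton (proj1 (H w)).
apply/eqP; rewrite -subr_eq0 -normr_le0; apply/ler_addgt0Pl => e e0; rewrite addr0.
have e20 : 0 < e / 2 by rewrite divr_gt0.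
have [d d0 Hd] := second_difference v e20 df (dG u).
have [d' d'0 Hd'] := second_difference u e20 df (dG v).
pose t := Num.min d d' / 2.
have m0 : 0 < Num.min d d' by rewrite lt_min d0.
have t0 : 0 < t by rewrite divr_gt0.
have tm : t < Num.min d d' by rewrite /t ltr_pdivrMr // ltr_pMr // ltr1n.
move: tm; rewrite lt_min => /andP[td td'].
have := Hd t; rewrite t0 td => /(_ isT) h1.
have := Hd' t; rewrite t0 td' => /(_ isT) h2.
have t20 : 0 < t ^+ 2 by rewrite exprn_gt0.
rewrite -(ler_pM2r t20) -[X in _ * X <= _](gtr0_norm t20) -normrM.
have -> : e * t ^+ 2 = e / 2 * t ^+ 2 + e / 2 * t ^+ 2 by field.
apply: le_trans (lerD h1 h2); apply: le_trans (ler_normB _ _).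
rewrite [x + t *: v + _]addrAC le_eqVlt; apply/orP; left; apply/eqP.
move: (f (x + t *: u + t *: v)) (f (x + t *: u)) (f (x + t *: v)) (f x)
  ('D_u ('D_v f) x) ('D_v ('D_u f) x) (t ^+ 2) => a b c r D D' q.
by congr (`|_|); ring.
Qed.

Lemma derive_entry V m n (f : V -> 'M[R]_(m, n)) x v i j : differentiable f x ->
  'D_v (fun y => f y i j : R) x = 'D_v f x i j.
Proof.
move=> df.
exact: (@derive_linear_comp R V _ R^o (mxentry i j) f x v (@mxentry_continuous R m n i j) df).
Qed.

Lemma near_derive_entry V m n (f : V -> 'M[R]_(m, n)) (x v : V) i j :
  (\forall y \near x, differentiable f y) ->
  {near x, 'D_v (fun y => f y i j : R) =1 fun y => 'D_v f y i j}.
Proof. by apply: filterS => y; exact: derive_entry. Qed.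

Lemma derive_swap V m n (f : V -> 'M[R]_(m, n)) (x u v : V) :
  ndiff 1 f x -> 'D_u ('D_v f) x = 'D_v ('D_u f) x.
Proof.
move=> nf; have [df H] := nf.
have dG w : differentiable ('D_w f) x := nbhs_singleton (proj1 (H w)).
apply/matrixP => i j.
have e1 := derive_entry u i j (dG v).
have e2 := derive_entry v i j (dG u).
rewrite -[LHS]e1.
rewrite -[RHS]e2.
have e3 := near_eq_derive u (near_derive_entry v i j df).
have e4 := near_eq_derive v (near_derive_entry u i j df).
rewrite -[LHS]e3.
rewrite -[RHS]e4.
by apply: derive_swap_real; exact: ndiff_entry.
Qed.

Lemma smooth_at_iter_derive V W (f : V -> W) x vs :
  smooth_at f x -> smooth_at (iter_derive vs f) x.
Proof.
elim/last_ind: vs f => //= vs v IH f sf.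
by rewrite iter_derive_rcons; apply: IH; exact: smooth_at_derive.
Qed.

(** The equality is carried on a whole open set because each induction step differentiates it once
    more. *)
Lemma iter_derive_move V m n (U : set V) (f : V -> 'M[R]_(m, n)) v us vs : open U ->
  (forall x, U x -> smooth_at f x) -> forall x, U x ->
  iter_derive (v :: us ++ vs) f x = iter_derive (us ++ v :: vs) f x.
Proof.
move=> oU sf; elim: us => // u us IH x Ux.
rewrite /= derive_swap; last by apply: smooth_at_iter_derive; exact: sf.
apply: near_eq_derive; apply: filterS (open_nbhs_nbhs (conj oU Ux)) => y Uy.
exact: IH.
Qed.

Lemma iter_derive_perm V m n (U : set V) (f : V -> 'M[R]_(m, n)) us vs : open U ->
  (forall x, U x -> smooth_at f x) -> perm_eq us vs -> forall x, U x ->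
  iter_derive us f x = iter_derive vs f x.
Proof.
move=> oU sf; elim: us vs => [|u us IH] vs.
  by rewrite perm_sym => /perm_nilP ->.
move=> pv; have uv : u \in vs by rewrite -(perm_mem pv) mem_head.
case/splitPr: uv pv => a b; rewrite perm_sym -[u :: b]cat1s perm_catCA /= perm_cons perm_sym => pv x Ux.
rewrite -(iter_derive_move u a b oU sf Ux) /=; apply: near_eq_derive.
by apply: filterS (open_nbhs_nbhs (conj oU Ux)) => y Uy; exact: IH.
Qed.

End Schwarz.

(** * Contact of maps *)

Section Agree.
Variable R : realType.
Implicit Types W : normedModType R.

Notation pvec := (delta_mx 0).

(* Equality of k-jets at [x], recursively on partial derivatives in any order:
   this form makes the chain rule an induction, and Schwarz's theorem reduces it
   to the sorted multi-indices used by [velocity]. *)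
Fixpoint agree p W (k : nat) (f g : 'rV[R]_p -> W) (x : 'rV[R]_p) : Prop :=
  f x = g x /\
  (if k is k'.+1 then forall i, agree k' ('D_(pvec i) f) ('D_(pvec i) g) x else True).

Lemma agree0 p W k (f g : 'rV[R]_p -> W) x : agree k f g x -> f x = g x.
Proof. by case: k => [|k] []. Qed.

Lemma agreeS p W k (f g : 'rV[R]_p -> W) x : agree k.+1 f g x -> agree k f g x.
Proof.
elim: k f g => [|k IH] f g [fg H]; split=> // i.
by apply: IH; exact: H.
Qed.

Lemma agree_refl p W k (f : 'rV[R]_p -> W) x : agree k f f x.
Proof. by elim: k f => [|k IH] f; split=> // i; exact: IH. Qed.

Lemma near_agree p W k (f f' g g' : 'rV[R]_p -> W) (x : 'rV[R]_p) :
  {near x, f =1 f'} -> {near x, g =1 g'} -> agree k f g x -> agree k f' g' x.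
Proof.
elim: k f f' g g' => [|k IH] f f' g g' ff gg [fg H]; split=> //.
- by rewrite -(nbhs_singleton ff) -(nbhs_singleton gg).
- by rewrite -(nbhs_singleton ff) -(nbhs_singleton gg).
- by move=> i; apply: IH (H i); exact: near_derive.
Qed.

Lemma agreeD p W k (f f' g g' : 'rV[R]_p -> W) x :
  smooth_at f x -> smooth_at f' x -> smooth_at g x -> smooth_at g' x ->
  agree k f f' x -> agree k g g' x ->
  agree k (fun y => f y + g y) (fun y => f' y + g' y) x.
Proof.
elim: k f f' g g' => [|k IH] f f' g g' sf sf' sg sg' [ff Hf] [gg Hg]; split;
  rewrite ?ff ?gg // => i.
have D (a b : 'rV[R]_p -> W) : smooth_at a x -> smooth_at b x ->
    {near x, (fun y => 'D_(pvec i) a y + 'D_(pvec i) b y) =1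
             'D_(pvec i) (fun y => a y + b y)}.
  move=> sa sb; apply: filterS2 (ndiff_diff (sa 0%N)) (ndiff_diff (sb 0%N)) => y ay by_.
  by rewrite -[RHS]/('D_(pvec i) (a + b) y) deriveD //; exact: diff_derivable.
apply: near_agree (D _ _ sf sg) (D _ _ sf' sg') _.
by apply: IH; (try exact: smooth_at_derive); [exact: Hf|exact: Hg].
Qed.

Lemma agreeM p k (f f' g g' : 'rV[R]_p -> R) x :
  smooth_at f x -> smooth_at f' x -> smooth_at g x -> smooth_at g' x ->
  agree k f f' x -> agree k g g' x ->
  agree k (fun y => f y * g y) (fun y => f' y * g' y) x.
Proof.
elim: k f f' g g' => [|k IH] f f' g g' sf sf' sg sg' aff agg;
  have [[ff Hf] [gg Hg]] := (aff, agg); split; rewrite ?ff ?gg // => i.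
have D (a b : 'rV[R]_p -> R) : smooth_at a x -> smooth_at b x ->
    {near x, (fun y => a y * 'D_(pvec i) b y + b y * 'D_(pvec i) a y) =1
             'D_(pvec i) (fun y => a y * b y)}.
  move=> sa sb; apply: filterS2 (ndiff_diff (sa 0%N)) (ndiff_diff (sb 0%N)) => y ay by_.
  by rewrite -[RHS]/('D_(pvec i) (a * b) y) deriveM //; exact: diff_derivable.
apply: near_agree (D _ _ sf sg) (D _ _ sf' sg') _.
have sD := @smooth_at_derive R _ _ _ x (pvec i).
apply: agreeD; try by apply: smooth_atM => //; exact: sD.
  by apply: IH => //; [exact: sD|exact: sD|exact: agreeS|exact: Hg].
by apply: IH => //; [exact: sD|exact: sD|exact: agreeS|exact: Hf].
Qed.

Lemma agree_sum p W k (I : Type) (s : seq I) (P : pred I)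
    (F F' : I -> 'rV[R]_p -> W) x :
  (forall i, smooth_at (F i) x) -> (forall i, smooth_at (F' i) x) ->
  (forall i, agree k (F i) (F' i) x) ->
  agree k (fun y => \sum_(i <- s | P i) F i y) (fun y => \sum_(i <- s | P i) F' i y) x.
Proof.
move=> sF sF' H; elim: s => [|i s IH].
  have E (G : I -> 'rV[R]_p -> W) : (fun y => \sum_(i <- [::] | P i) G i y) = cst 0.
    by apply/funext => y; rewrite big_nil.
  by rewrite !E; exact: agree_refl.
have E (G : I -> 'rV[R]_p -> W) : (fun y => \sum_(j <- i :: s | P j) G j y) =
    if P i then fun y => G i y + \sum_(j <- s | P j) G j y
    else fun y => \sum_(j <- s | P j) G j y.
  by case: ifP => Pi; apply/funext => y; rewrite big_cons Pi.
rewrite !E; case: ifP => // Pi.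
by apply: agreeD => //; apply: smooth_at_sum.
Qed.

Lemma agree_entry p m n k (f g : 'rV[R]_p -> 'M[R]_(m, n)) x i j :
  smooth_at f x -> smooth_at g x -> agree k f g x ->
  agree k (fun y => f y i j : R) (fun y => g y i j) x.
Proof.
elim: k f g => [|k IH] f g sf sg [fg H]; split; rewrite ?fg // => l.
have D h (sh : smooth_at h x) := near_derive_entry (pvec l) i j (ndiff_diff (sh 0%N)).
have sD := @smooth_at_derive R _ _ _ x (pvec l).
have := IH _ _ (sD _ _ sf) (sD _ _ sg) (H l).
by apply: near_agree; [move: (D _ sf)|move: (D _ sg)]; apply: filterS => y ->.
Qed.

Lemma agree_mx p m n k (f g : 'rV[R]_p -> 'M[R]_(m, n)) x :
  smooth_at f x -> smooth_at g x ->
  (forall i j, agree k (fun y => f y i j : R) (fun y => g y i j) x) ->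
  agree k f g x.
Proof.
elim: k f g => [|k IH] f g sf sg H; split.
- by apply/matrixP => i j; have [] := H i j.
- by [].
- by apply/matrixP => i j; have [] := H i j.
move=> l; have sD := @smooth_at_derive R _ _ _ x (pvec l).
apply: IH; [exact: sD|exact: sD|move=> i j].
have [_ Hl] := H i j; apply: near_agree (Hl l).
  exact: (near_derive_entry (pvec l) i j (ndiff_diff (sf 0%N))).
exact: (near_derive_entry (pvec l) i j (ndiff_diff (sg 0%N))).
Qed.

Lemma derive_comp_rV p m W (g : 'rV[R]_m -> W) (f : 'rV[R]_p -> 'rV[R]_m) x v :
  differentiable f x -> differentiable g (f x) ->
  'D_v (g \o f) x = \sum_i 'D_v f x 0 i *: 'D_(pvec i) g (f x).
Proof. by move=> df dg; rewrite derive_comp_mx // big_ord1. Qed.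

(** One derivative turns the composite into a sum of products of an entry of the derivative of [f]
    with a composite involving a partial derivative of [g]; induction on [k] and the Leibniz rule
    [agreeM] conclude. *)
Lemma agree_comp_real p m k (f f' : 'rV[R]_p -> 'rV[R]_m) (g g' : 'rV[R]_m -> R) x :
  smooth_at f x -> smooth_at f' x ->
  smooth_at g (f x) -> smooth_at g' (f x) ->
  agree k f f' x -> agree k g g' (f x) -> agree k (g \o f) (g' \o f') x.
Proof.
move=> sf sf'; elim: k g g' => [|k IH] g g' sg sg' aff agg;
  have [[ff Hf] [gg Hg]] := (aff, agg); split; rewrite /= -?ff // => i.
have sD := @smooth_at_derive R _ _ _ x (pvec i).
have D (a : 'rV[R]_p -> 'rV[R]_m) (b : 'rV[R]_m -> R) : smooth_at a x -> smooth_at b (a x) ->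
    {near x, (fun y => \sum_j 'D_(pvec i) a y 0 j * 'D_(pvec j) b (a y)) =1
             'D_(pvec i) (b \o a)}.
  move=> sa sb; have ca := smooth_at_continuous sa.
  have db : \forall y \near x, differentiable b (a y) := ca _ (ndiff_diff (sb 0%N)).
  by apply: filterS2 (ndiff_diff (sa 0%N)) db => y ay by_; exact: (esym (derive_comp_rV _ ay by_)).
have sg'2 : smooth_at g' (f' x) by rewrite -ff.
apply: near_agree (D _ _ sf sg) (D _ _ sf' sg'2) _.
have s1 j (h : 'rV[R]_p -> 'rV[R]_m) : smooth_at h x -> smooth_at (fun y => 'D_(pvec i) h y 0 j : R) x.
  by move=> sh; apply: smooth_at_entry; exact: sD.
have s2 j (a : 'rV[R]_p -> 'rV[R]_m) (b : 'rV[R]_m -> R) : smooth_at a x -> smooth_at b (a x) -> smooth_at (fun y => 'D_(pvec j) b (a y) : R) x.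
  move=> sa sb.
  by apply: (smooth_at_comp_real (g := 'D_(pvec j) b) sa); exact: smooth_at_derive.
apply: agree_sum => j.
- by apply: smooth_atM; [exact: s1|exact: s2].
- by apply: smooth_atM; [exact: s1|exact: s2].
apply: agreeM; try exact: s1; try exact: s2.
  by apply: agree_entry; [exact: sD|exact: sD|exact: Hf].
by apply: (IH ('D_(pvec j) g) ('D_(pvec j) g'));
  [exact: smooth_at_derive|exact: smooth_at_derive|exact: agreeS|exact: Hg].
Qed.

Lemma agree_comp p m m' n' k (f f' : 'rV[R]_p -> 'rV[R]_m)
    (g g' : 'rV[R]_m -> 'M[R]_(m', n')) x :
  smooth_at f x -> smooth_at f' x ->
  smooth_at g (f x) -> smooth_at g' (f x) ->
  agree k f f' x -> agree k g g' (f x) -> agree k (g \o f) (g' \o f') x.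
Proof.
move=> sf sf' sg sg' aff agg; have ff := agree0 aff.
apply: agree_mx; [exact: smooth_at_comp| by apply: smooth_at_comp; rewrite // -ff|].
move=> i j; apply: (@agree_comp_real p m k f f' (fun y => g y i j) (fun y => g' y i j)) => //.
- exact: smooth_at_entry.
- exact: smooth_at_entry.
- exact: agree_entry.
Qed.

Lemma agreeP p W k (f g : 'rV[R]_p -> W) x :
  agree k f g x <-> forall s : seq 'I_p, (size s <= k)%N ->
    iter_derive [seq pvec i | i <- s] f x = iter_derive [seq pvec i | i <- s] g x.
Proof.
split=> [|H].
  elim: k f g => [|k IH] f g [fg H] s; first by rewrite leqn0 size_eq0 => /eqP->.
  case/lastP: s => [|s i]; first by [].
  by rewrite size_rcons ltnS map_rcons !iter_derive_rcons => sk; apply: IH sk; exact: H.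
elim: k f g H => [|k IH] f g H; split; try by apply: (H [::]).
  by [].
move=> i; apply: IH => s sk.
by have := H (rcons s i); rewrite size_rcons map_rcons !iter_derive_rcons; apply.
Qed.

Lemma sum_count_mem (I : finType) (s : seq I) : (\sum_i count_mem i s)%N = size s.
Proof.
elim: s => [|j s IH] /=; first by rewrite big1.
rewrite big_split /= IH (bigD1 j) //= eqxx big1 ?addn0 ?add1n // => i ij.
by rewrite eq_sym (negbTE ij).
Qed.

(** The multi-index counting the occurrences of each variable; [inord] truncates nothing as long as
    [size s <= k]. *)
Definition index_of_seq p k (s : seq 'I_p) : {ffun 'I_p -> 'I_k.+1} :=
  [ffun i => inord (count_mem i s)].

Lemma index_of_seqE p k (s : seq 'I_p) i : (size s <= k)%N ->
  index_of_seq k s i = count_mem i s :> nat.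
Proof.
move=> sk; rewrite ffunE inordK // ltnS (leq_trans _ sk) //.
by rewrite count_size.
Qed.

Lemma index_of_seqP p k (s : seq 'I_p) : (size s <= k)%N ->
  (\sum_i index_of_seq k s i <= k)%N.
Proof.
move=> sk; rewrite (eq_bigr (fun i => count_mem i s)) ?sum_count_mem // => i _.
by rewrite index_of_seqE.
Qed.

Lemma perm_seq_of_index p k (s : seq 'I_p) : (size s <= k)%N ->
  perm_eq (flatten [seq nseq (index_of_seq k s i) i | i <- enum 'I_p]) s.
Proof.
move=> sk; apply/allP => a _ /=; apply/eqP.
rewrite count_flatten -map_comp sumnE big_map big_enum /=.
rewrite (bigD1 a) //= count_nseq index_of_seqE //= eqxx mul1n big1 ?addn0 // => i ia.
by rewrite count_nseq /= (negbTE ia).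
Qed.

Lemma partial_deriveE p k W (J : multi_index p k) (f : 'rV[R]_p -> W) :
  partial_derive J f = iter_derive
    [seq pvec i | i <- flatten [seq nseq (val J i) i | i <- enum 'I_p]] f.
Proof.
rewrite /partial_derive map_flatten; congr (iter_derive (flatten _) f).
rewrite -[RHS]map_comp.
by apply: eq_map => i /=; rewrite map_nseq.
Qed.

(** A sequence of at most [k] variables is a permutation of the sorted sequence of its multi-index,
    and [iter_derive_perm] makes the order immaterial; this is why smoothness is required on an open
    set around [x]. *)
Lemma agree_partial p m n k (U : set 'rV[R]_p) (f g : 'rV[R]_p -> 'M[R]_(m, n)) x :
  open U -> smooth_on U f -> smooth_on U g -> U x ->
  agree k f g x <-> forall J : multi_index p k,
    partial_derive J f x = partial_derive J g x.
Proof.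
move=> oU /(smooth_onP _ oU) sf /(smooth_onP _ oU) sg Ux; split=> [/agreeP H J|H].
  rewrite !partial_deriveE; apply: H.
  rewrite size_flatten /shape -map_comp sumnE big_map big_enum /=.
  rewrite (eq_bigr (fun i => val J i : nat)); first exact: (valP J).
  by move=> i _; rewrite size_nseq.
apply/agreeP => s sk.
have := H (exist _ (index_of_seq k s) (index_of_seqP sk)).
rewrite !partial_deriveE /= => E.
have ps : perm_eq
    [seq pvec i | i <- flatten [seq nseq (index_of_seq k s i) i | i <- enum 'I_p]]
    [seq (pvec i : 'rV[R]_p) | i <- s] by apply: perm_map; exact: perm_seq_of_index.
by rewrite -(iter_derive_perm oU sf ps Ux) -(iter_derive_perm oU sg ps Ux).
Qed.

Lemma velocity_agree m (M : topologicalType) p k (c c' : chart R m M)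
    (U : set 'rV[R]_p) (f g : 'rV[R]_p -> M) :
  open U -> U 0 -> smooth_on U (c \o f) -> smooth_on U (c' \o g) ->
  velocity k c f = velocity k c' g <-> agree k (c \o f) (c' \o g) 0.
Proof.
move=> oU U0 sf sg; rewrite (agree_partial k oU sf sg U0); split=> [H J|H].
  apply/rowP => a; move/matrixP/(_ (enum_rank J) a) : H.
  by rewrite !mxE !enum_rankK.
by apply/matrixP => i a; rewrite !mxE H.
Qed.

End Agree.

(** * Local inverses *)

Section LocalInverse.
Variable R : realType.
Implicit Types V W : normedModType R.

(** The Jacobian for row vectors: differentials act by multiplication on the right, so an injective
    differential means a [row_free] matrix. *)
Definition derive_mxf p n (f : 'rV[R]_p -> 'rV[R]_n) (x : 'rV[R]_p) : 'M[R]_(p, n) :=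
  \matrix_(i, j) 'D_(delta_mx 0 i) f x 0 j.

Lemma derive_mxfE p n (f : 'rV[R]_p -> 'rV[R]_n) x v :
  differentiable f x -> 'D_v f x = v *m derive_mxf f x.
Proof.
move=> df; rewrite deriveE // {1}[v]row_sum_delta linear_sum.
apply/rowP => j; rewrite summxE mxE; apply: eq_bigr => i _.
by rewrite linearZ mxE mxE deriveE.
Qed.

Lemma smooth_at_derive_mxf p n (f : 'rV[R]_p -> 'rV[R]_n) x :
  smooth_at f x -> smooth_at (derive_mxf f) x.
Proof.
move=> sf; apply: smooth_at_mx => i j.
have -> : (fun y => derive_mxf f y i j) = fun y => 'D_(delta_mx 0 i) f y 0 j.
  by apply/funext => y; rewrite mxE.
by apply: smooth_at_entry; exact: smooth_at_derive.
Qed.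

Lemma mulmxr_lipschitz m n k (B : 'M[R]_(n, k)) :
  exists2 K : R, 0 < K & forall A : 'M[R]_(m, n), `|A *m B| <= K * `|A|.
Proof.
exact: (linear_lipschitz (linear_mx_continuous (L := mulmxr B))).
Qed.

(** Formal differentiation of [F \o h = G] gives the candidate ['d G y v *m B]. By continuity of [h]
    the error [rho] of [F] is at most [e1 * |d|]; absorbing it in the left side bounds [|d|] by
    [C * |v|], after which [rho] is small compared with [v] as well. *)
Lemma differentiable_left_inverse V p (F : 'rV[R]_p -> 'rV[R]_p) (h : V -> 'rV[R]_p) y :
  differentiable F (h y) -> derive_mxf F (h y) \in unitmx ->
  {for y, continuous h} -> differentiable (F \o h) y ->
  differentiable h y /\
  forall v, 'D_v h y = 'D_v (F \o h) y *m invmx (derive_mxf F (h y)).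
Proof.
set A := derive_mxf F (h y) => dF uA ch dG; set G := F \o h; set B := invmx A.
have [k k0 Hk] := mulmxr_lipschitz 1 B.
have [l l0 Hl] := linear_lipschitz (diff_continuous dG).
have cL : continuous (mulmxr B \o 'd G y).
  move=> z; apply: continuous_comp; first exact: diff_continuous.
  exact: (linear_mx_continuous (L := mulmxr B)).
suff [dh dhE] : differentiable h y /\ 'd h y = mulmxr B \o 'd G y :> (V -> 'rV_p).
  by split=> // v; rewrite deriveE // dhE /= deriveE.
apply: (@differentiableI R V _ h y (mulmxr B \o 'd G y : {linear _ -> _}) cL) => e e0.
pose C := 2 * k * (l + 1).
have C0 : 0 < C by rewrite !mulr_gt0 // ltr_wpDl // ltW.
(* The first bound lets [k * |rho|] be absorbed in [|d| / 2]; the second turns [|d| <= C * |v|] into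
   [k * |rho| <= e / 2 * |v|]. *)
pose e1 := Num.min (1 / (2 * k)) (e / (2 * k * C)).
have kge : 0 <= k := ltW k0.
have k20 : 0 < 2 * k by rewrite mulr_gt0.
have e10 : 0 < e1 by rewrite lt_min !divr_gt0 // mulr_gt0.
(* The bound 1 accounts for the 1 in [l + 1]; the other gives the remaining half of the error. *)
pose e2 := Num.min 1 (e / (2 * k)).
have e20 : 0 < e2 by rewrite lt_min ltr01 divr_gt0.
have nF : \forall z \near y,
    `|F (h z) - F (h y) - 'd F (h y) (h z - h y)| <= e1 * `|h z - h y|.
  exact: (ch _ (differentiable_bound dF e10)).
apply: filterS2 nF (differentiable_bound dG e20) => z.
rewrite -(deriveE _ dF) (derive_mxfE _ dF) -/A /=.
set d := h z - h y; set v := z - y => b1 b2.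
pose rho := F (h z) - F (h y) - d *m A; pose rh2 := G z - G y - 'd G y v.
have dE : d = (G z - G y - rho) *m B.
  by rewrite /rho /G /= opprB addrC subrK mulmxK.
have bd : `|d| <= C * `|v|.
  have h1 : `|d| <= k * ((l + 1) * `|v| + e1 * `|d|).
    rewrite {1}dE; apply: le_trans (Hk _) _; rewrite ler_wpM2l //.
    apply: le_trans (ler_normB _ _) _; apply: lerD => //.
    have -> : G z - G y = rh2 + 'd G y v by rewrite subrK.
    apply: le_trans (ler_normD _ _) _; rewrite addrC mulrDl; apply: lerD => //.
    apply: le_trans b2 _; rewrite ler_wpM2r //.
    by rewrite ge_min lexx.
  have h2 : k * (e1 * `|d|) <= `|d| / 2.
    rewrite mulrA mulrC ler_wpM2l // -ler_pdivlMl //.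
    by rewrite ge_min mul1r invfM mulrC lexx.
  have : `|d| <= k * (l + 1) * `|v| + `|d| / 2.
    by apply: le_trans h1 _; rewrite mulrDr -mulrA lerD2l.
  have -> : C * `|v| = 2 * (k * (l + 1) * `|v|) by rewrite /C; ring.
  by move: (k * (l + 1) * `|v|) (`|d|) => X Y; lra.
have -> : d - 'd G y v *m B = (rh2 - rho) *m B.
  rewrite {1}dE -mulmxBl; congr (_ *m _); rewrite /rh2.
  by rewrite addrAC.
apply: le_trans (Hk _) _.
have h1 : k * `|rh2| <= e / 2 * `|v|.
  apply: le_trans (_ : k * (e2 * `|v|) <= _); first by rewrite ler_wpM2l //.
  rewrite mulrA ler_wpM2r // mulrC -ler_pdivlMr //.
  by rewrite ge_min invfM mulrA lexx orbT.
have h2 : k * `|rho| <= e / 2 * `|v|.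
  apply: le_trans (_ : k * (e1 * `|d|) <= _); first by rewrite ler_wpM2l //.
  apply: le_trans (_ : k * (e / (2 * k * C) * (C * `|v|)) <= _).
    rewrite ler_wpM2l //; apply: ler_pM => //; first exact: ltW.
    by rewrite ge_min lexx orbT.
  rewrite le_eqVlt; apply/orP; left; apply/eqP.
  by field; rewrite !gt_eqF.
apply: le_trans (_ : k * `|rh2| + k * `|rho| <= _).
  by rewrite -mulrDr ler_wpM2l // ler_normB.
by apply: le_trans (lerD h1 h2) _; rewrite -mulrDl -splitr.
Qed.

(* Only the regularity half of the inverse function theorem: the inverse [h] is
   given and continuous, as it comes from an embedding. *)
Lemma smooth_at_left_inverse V p (F : 'rV[R]_p -> 'rV[R]_p) (h : V -> 'rV[R]_p) x :
  smooth_at F (h x) -> derive_mxf F (h x) \in unitmx ->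
  (\forall y \near x, {for y, continuous h}) -> smooth_at (F \o h) x ->
  smooth_at h x.
Proof.
move=> sF uF ch sG; have sJ := smooth_at_derive_mxf sF.
have chx := nbhs_singleton ch.
have dF : \forall y \near x, differentiable F (h y) := chx _ (ndiff_diff (sF 0%N)).
have det0 : \det (derive_mxf F (h x)) != 0 by rewrite -unitfE -unitmxE.
have uJ : \forall y \near x, derive_mxf F (h y) \in unitmx.
  have sd : smooth_at (fun u => \det (derive_mxf F u) : R) (h x).
    by apply: smooth_at_det => i j; exact: smooth_at_entry.
  have nd0 : nbhs (\det (derive_mxf F (h x))) [set t : R | t != 0].
    by apply: open_nbhs_nbhs; split=> //; exact: open_neq.
  have nd : \forall u \near h x, \det (derive_mxf F u) != 0 :=
    smooth_at_continuous sd nd0.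
  have nd' : \forall y \near x, \det (derive_mxf F (h y)) != 0 := chx _ nd.
  by apply: filterS nd' => y; rewrite unitmxE unitfE.
have Dh : \forall y \near x, differentiable h y /\
    forall v, 'D_v h y = 'D_v (F \o h) y *m invmx (derive_mxf F (h y)).
  have dG := ndiff_diff (sG 0%N).
  apply: filterS2 (filterI dF uJ) (filterI ch dG) => y [? ?] [? ?].
  exact: differentiable_left_inverse.
(* Bootstrap: the derivative of [h] is expressed through [h] itself, so order [r] for [h] gives
   order [r] for its derivatives. *)
elim=> [|r IH]; split=> //; try by apply: filterS Dh => y [].
move=> v; have sI := ndiff_comp IH (smooth_at_invmx det0 sJ r).
apply: near_ndiff (ndiff_mulmx (smooth_at_derive v sG r) sI).
apply: filterS2 Dh uJ => y [_ ->] uy /=.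
by rewrite /invmx uy.
Qed.

(** In the max norm each coordinate of [v *m (J - 1)] is a sum of [p] products, whence the constant;
    [p.+1] keeps it positive when [p = 0]. *)
Lemma mx_near_1_bound p (J : 'M[R]_p) (v : 'rV[R]_p) :
  (forall i j, `|J i j - (1%:M : 'M[R]_p) i j| <= (2 * p.+1%:R)^-1) ->
  `|v *m J - v| <= `|v| / 2.
Proof.
move=> HJ; rewrite -{2}[v]mulmx1 -mulmxBr.
rewrite [leLHS]/Num.Def.normr /= mx_normrE; apply: bigmax_le.
  by rewrite divr_ge0.
move=> [i j] _ /=; rewrite mxE.
apply: le_trans (ler_norm_sum _ _ _) _.
apply: le_trans (_ : \sum_(l < p) `|v| * (2 * p.+1%:R)^-1 <= _).
  apply: ler_sum => l _; rewrite normrM; apply: ler_pM => //.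
    by rewrite [leRHS]/Num.Def.normr /= mx_normrE; exact: (le_bigmax _ _ (i, l)).
  by have := HJ l j; rewrite !mxE.
rewrite sumr_const card_ord -[X in X <= _]mulr_natr -mulrA ler_wpM2l //.
rewrite invfM -mulrA ler_piMr // mulrC ler_pdivrMr ?ltr0n // mul1r ler_nat.
by rewrite leqnSn.
Qed.

(** The Jacobian of [g - id] is close to 0 near [x0], and a ball is convex: the mean value theorem,
    coordinate by coordinate along a segment, makes [g - id] contract by 1/2. The triangle
    inequality then gives the factor 2. *)
Lemma lower_lipschitz p (g : 'rV[R]_p -> 'rV[R]_p) (x0 : 'rV[R]_p) :
  smooth_at g x0 -> derive_mxf g x0 = 1%:M ->
  exists2 r : R, 0 < r &
    (forall x y, ball x0 r x -> ball x0 r y -> `|x - y| <= 2 * `|g x - g y|) /\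
    (forall x, ball x0 r x -> differentiable g x /\ injective ('d g x)).
Proof.
move=> sg g1; have sJ := smooth_at_derive_mxf sg.
have e0 : 0 < (2 * p.+1%:R : R)^-1 by rewrite invr_gt0 mulr_gt0 // ltr0n.
pose Q i j x := `|derive_mxf g x i j - (1%:M : 'M[R]_p) i j| <= (2 * p.+1%:R)^-1.
have nQ i j : \forall x \near x0, Q i j x.
  have cij := smooth_at_continuous (smooth_at_entry i j sJ).
  have /cvgrPdist_le/(_ _ e0) := cij; apply: filterS => x /=.
  by rewrite distrC g1.
have nQi i : \forall x \near x0, forall j, Q i j x.
  exact: (@filter_forall _ 'I_p (Q i) (nbhs x0) _ (nQ i)).
have nJ : \forall x \near x0, forall i j, Q i j x.
  exact: (@filter_forall _ 'I_p (fun i x => forall j, Q i j x) (nbhs x0) _ nQi).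
have nA : nbhs x0 [set x | differentiable g x /\ forall i j, Q i j x].
  exact: filterI (ndiff_diff (sg 0%N)) nJ.
have [r /= r0 Hr] := (nbhs_ballP _ _).1 nA.
exists r => //; split; last first.
  move=> x /Hr [dx Jx]; split=> // v w dvw.
  have : 'd g x (v - w) = 0 by rewrite linearB dvw subrr.
  rewrite -deriveE // derive_mxfE // => E.
  have := mx_near_1_bound (v - w) Jx; rewrite E sub0r normrN => H.
  apply/eqP; rewrite -subr_eq0 -normr_le0.
  by have := normr_ge0 (v - w); move: (`|v - w|) H => t; lra.
move=> x y bx by_; set v := x - y.
have seg (t : R) : 0 <= t <= 1 -> ball x0 r (y + t *: v).
  move=> /andP[t0 t1]; rewrite -ball_normE /=.
  have -> : x0 - (y + t *: v) = (1 - t) *: (x0 - y) + t *: (x0 - x).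
    rewrite /v !scalerBr !scalerBl !scale1r; apply/rowP => i; rewrite !mxE; ring.
  move: bx by_; rewrite -ball_normE /= => bx by_.
  apply: le_lt_trans (ler_normD _ _) _; rewrite !normrZ !ger0_norm ?subr_ge0 //.
  have [->|t0'] := eqVneq t 0; first by rewrite subr0 mul1r mul0r addr0.
  have tp : 0 < t by rewrite lt_def t0'.
  have -> : r = (1 - t) * r + t * r by ring.
  by apply: ler_ltD; [rewrite ler_wpM2l ?subr_ge0 // ltW|rewrite ltr_pM2l].
have key : `|g x - g y - v| <= `|v| / 2.
  rewrite [leLHS]/Num.Def.normr /= mx_normrE; apply: bigmax_le.
    by rewrite divr_ge0.
  move=> [i j] _ /=; rewrite (ord1 i).
  pose f t : R := g (y + t *: v) 0 j - t * v 0 j.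
  pose df t : R := 'D_v g (y + t *: v) 0 j - v 0 j.
  have dp (t : R) : 0 <= t <= 1 -> is_derive t (1 : R) f (df t).
    move=> ht; have [dg _] := Hr _ (seg t ht).
    apply: is_deriveB.
      rewrite -(derive_entry v 0 j dg).
      apply: (@is_derive_line R _ R^o (fun z => g z 0 j)).
      exact: (differentiable_comp dg (differentiable_coord _ _ _)).
    have dl : is_diff t ( *:%R^~ (v 0 j : R^o)) ( *:%R^~ (v 0 j : R^o)).
      exact: is_diff_scalel.
    have dd := @ex_diff _ _ _ _ _ _ _ dl.
    apply: DeriveDef; first exact: diff_derivable.
    have -> : (fun t => t * v 0 j) = *:%R^~ (v 0 j : R^o) by [].
    by rewrite deriveE // diff_val scale1r.
  have [||t ht Et] := @MVT_segment R f df 0 1 ler01.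
  - by move=> t; rewrite in_itv /= => /andP[s0 st]; apply: dp; rewrite !ltW.
  - apply: derivable_within_continuous => t; rewrite in_itv /= => ht.
    by case: (dp t ht).
  move: ht; rewrite in_itv /= => ht; have [dg Jg] := Hr _ (seg t ht).
  have -> : (g x - g y - v) 0 j = df t.
    move: Et; rewrite subr0 mulr1 => <-; rewrite /f !mxE.
    by rewrite scale0r scale1r addr0 [y + v]addrC subrK; ring.
  rewrite /df derive_mxfE //; apply: le_trans (mx_near_1_bound v Jg).
  rewrite [leRHS]/Num.Def.normr /= mx_normrE.
  apply: le_trans (le_bigmax _ _ (0, j)); by rewrite !mxE.
have := ler_normB (g x - g y) (g x - g y - v).
rewrite opprB [_ + (v - _)]addrC subrK => H.
by move: key H; move: (`|v|) (`|g x - g y - v|) (`|g x - g y|) => a b c; lra.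
Qed.

End LocalInverse.

(** * Maps between manifolds *)

Section ManifoldMaps.
Variable R : realType.
Implicit Types V W : normedModType R.

Section Charts.
Variables (m : nat) (M : topologicalType) (AM : manifold R m M).
Implicit Types c : chart R m M.

Definition smoothM V (f : V -> M) (x : V) : Prop :=
  {for x, continuous f} /\
  forall c, atlas AM c -> cdom c (f x) -> smooth_at (c \o f) x.

Definition immersive V (f : V -> M) (x : V) : Prop :=
  forall c, atlas AM c -> cdom c (f x) -> injective ('d (c \o f) x).

Lemma cimg_map c z : cdom c z -> cimg c (c z).
Proof. by move=> cz; exists z. Qed.

Lemma cinv_dom c x : cimg c x -> cdom c (cinv c x).
Proof. by case=> z cz <-; rewrite cmapK. Qed.

Lemma cinvK c x : cimg c x -> c (cinv c x) = x.
Proof. by case=> z cz <-; rewrite cmapK. Qed.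

Lemma near_cdom c z : cdom c z -> \forall w \near z, cdom c w.
Proof. by move=> cz; apply: open_nbhs_nbhs; split=> //; exact: cdom_open. Qed.

Lemma near_cimg c x : cimg c x -> \forall w \near x, cimg c w.
Proof. by move=> cx; apply: open_nbhs_nbhs; split=> //; exact: cimg_open. Qed.

Lemma open_preimage_on (X Y : topologicalType) (f : X -> Y) U O :
  open U -> open O -> (forall x, U x -> {for x, continuous f}) ->
  open (U `&` f @^-1` O).
Proof.
move=> oU oO cf; rewrite openE => x [Ux Ox].
apply: filterI; first exact: (open_nbhs_nbhs (conj oU Ux)).
by apply: (cf x Ux); exact: (open_nbhs_nbhs (conj oO Ox)).
Qed.

Lemma smooth_intoP V (U : set V) (f : V -> M) : open U ->
  smooth_into AM U f <-> forall x, U x -> smoothM f x.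
Proof.
move=> oU.
have oUc c : (forall x, U x -> {for x, continuous f}) -> open (U `&` f @^-1` cdom c).
  by move=> cf; apply: open_preimage_on => //; exact: cdom_open.
split=> [[cf sf] x Ux|H].
  split; first exact: cf.
  move=> c ac cx; have := sf c ac; rewrite smooth_onP; last exact: oUc.
  by apply.
have cf x : U x -> {for x, continuous f} by move=> /H[].
split=> // c ac; rewrite smooth_onP; last exact: oUc.
by move=> x [Ux cx]; apply: (H x Ux).2.
Qed.

Lemma chart_change c c' z : atlas AM c -> atlas AM c' -> cdom c z -> cdom c' z ->
  smooth_at (c' \o cinv c) (c z).
Proof.
move=> ac ac' cz cz'.
have E : c @` (cdom c `&` cdom c') = cimg c `&` cinv c @^-1` cdom c'.
  rewrite eqEsubset; split=> x.
    by case=> w [cw cw'] <-; split; [exact: cimg_map|rewrite /= cmapK].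
  by case=> cx cx'; exists (cinv c x); rewrite ?cinvK //; split=> //; exact: cinv_dom.
have oE : open (c @` (cdom c `&` cdom c')).
  rewrite E; apply: open_preimage_on; [exact: cimg_open|exact: cdom_open|].
  exact: cinv_continuous.
have := atlas_compatible ac ac'; rewrite smooth_onP //; apply.
by exists z.
Qed.

Lemma near_continuous_cdom V (f : V -> M) (x : V) c :
  {for x, continuous f} -> cdom c (f x) -> \forall y \near x, cdom c (f y).
Proof. by move=> cf cx; exact: (cf _ (near_cdom cx)). Qed.

Lemma smoothM_of_chart V (f : V -> M) (x : V) c :
  {for x, continuous f} -> atlas AM c -> cdom c (f x) ->
  smooth_at (c \o f) x -> smoothM f x.
Proof.
move=> cf ac cx sf; split=> // c' ac' cx'.
have s : smooth_at ((c' \o cinv c) \o (c \o f)) x.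
  by apply: smooth_at_comp => //; exact: chart_change.
apply: smooth_at_near s; apply: filterS (near_continuous_cdom cf cx) => y cy /=.
by rewrite cmapK.
Qed.

Lemma near_smoothM V (f g : V -> M) (x : V) :
  {near x, f =1 g} -> smoothM f x -> smoothM g x.
Proof.
move=> fg [cf sf]; have fgx := nbhs_singleton fg; split.
  rewrite /prop_for /continuous_at -fgx.
  by apply: cvg_trans cf; exact: near_eq_cvg.
move=> c ac; rewrite -fgx => cx; apply: smooth_at_near (sf c ac cx).
by apply: filterS fg => y /= ->.
Qed.

Lemma smoothM_cinv c x : atlas AM c -> cimg c x -> smoothM (cinv c) x.
Proof.
move=> ac cx; apply: (smoothM_of_chart _ ac).
- exact: cinv_continuous.
- exact: cinv_dom.
apply: (smooth_at_near _ (smooth_at_id x)).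
by apply: filterS (near_cimg cx) => y cy /=; rewrite cinvK.
Qed.

Lemma smoothM_comp V p q (f : V -> 'M[R]_(p, q)) (g : 'M[R]_(p, q) -> M) x :
  smooth_at f x -> smoothM g (f x) -> smoothM (g \o f) x.
Proof.
move=> sf [cg sg]; split.
  by apply: continuous_comp => //; exact: smooth_at_continuous.
by move=> c ac cx; apply: (smooth_at_comp (g := c \o g)) => //; exact: sg.
Qed.

Lemma smoothM_affine V W (L : {linear V -> W}) (a : W) (g : W -> M) x :
  continuous L -> smoothM g (a + L x) -> smoothM (fun y => g (a + L y)) x.
Proof.
move=> cL [cg sg]; split.
  apply: (@continuous_comp _ _ _ (fun y => a + L y) g) => //.
  by apply: cvgD; [exact: cvg_cst|exact: cL].
move=> c ac cx; exact: (smooth_at_affine (g := c \o g) cL (sg c ac cx)).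
Qed.

Lemma smoothM_shift V (g : V -> M) (a x : V) :
  smoothM g (a + x) -> smoothM (fun y => g (a + y)) x.
Proof. by apply: (@smoothM_affine V V idfun) => y. Qed.

(** Makes changes of chart an instance of the statements on smooth maps. *)
Lemma smooth_map_id : smooth_map AM AM id.
Proof.
move=> c ac; rewrite smooth_intoP; last exact: cimg_open.
by move=> x cx; exact: smoothM_cinv.
Qed.

End Charts.

Section Maps.
Variables (m n : nat) (M N : topologicalType).
Variables (AM : manifold R m M) (AN : manifold R n N) (F : M -> N).
Hypothesis sF : smooth_map AM AN F.

Lemma smoothM_chartmap c x : atlas AM c -> cimg c x -> smoothM AN (F \o cinv c) x.
Proof.
move=> ac cx; have := sF ac; rewrite smooth_intoP; last exact: cimg_open.
exact.
Qed.

Lemma smoothM_map V (f : V -> M) x : smoothM AM f x -> smoothM AN (F \o f) x.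
Proof.
move=> [cf sf]; have [c ac cx] := atlas_cover AM (f x).
have sFf : smoothM AN ((F \o cinv c) \o (c \o f)) x.
  apply: smoothM_comp; first exact: sf.
  by apply: smoothM_chartmap => //; exact: cimg_map.
apply: near_smoothM sFf; apply: filterS (near_continuous_cdom cf cx) => y cy /=.
by rewrite cmapK.
Qed.

Lemma smooth_map_at c c' z : atlas AM c -> cdom c z -> atlas AN c' -> cdom c' (F z) ->
  smooth_at (c' \o F \o cinv c) (c z).
Proof.
move=> ac cz ac' cz'; have [_] := smoothM_chartmap ac (cimg_map cz).
by apply=> //=; rewrite cmapK.
Qed.

Lemma smooth_map_continuous z : {for z, continuous F}.
Proof.
have [c ac cz] := atlas_cover AM z.
have [cF _] := smoothM_chartmap ac (cimg_map cz).
have cFc : {for z, continuous ((F \o cinv c) \o c)}.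
  by apply: continuous_comp; [exact: cmap_continuous|exact: cF].
rewrite /prop_for /continuous_at -{2}(cmapK cz).
apply: cvg_trans cFc; apply: near_eq_cvg.
by apply: filterS (near_cdom cz) => w cw /=; rewrite cmapK.
Qed.

Lemma near_chart_factor V (f : V -> M) (x : V) (c : chart R m M) (c' : chart R n N) :
  {for x, continuous f} -> cdom c (f x) ->
  {near x, (c' \o F \o cinv c) \o (c \o f) =1 c' \o F \o f}.
Proof.
move=> cf cx; apply: filterS (near_continuous_cdom cf cx) => y cy /=.
by rewrite cmapK.
Qed.

Lemma diff_chart_factor V (f : V -> M) (x v : V) c c' :
  smoothM AM f x -> atlas AM c -> cdom c (f x) -> atlas AN c' -> cdom c' (F (f x)) ->
  'd (c' \o F \o f) x v = 'd (c' \o F \o cinv c) (c (f x)) ('d (c \o f) x v).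
Proof.
move=> sf ac cx ac' cx'; have [cf sfc] := sf.
have d1 := smooth_at_differentiable (sfc c ac cx).
have d2 := smooth_at_differentiable (smooth_map_at ac cx ac' cx').
have [_ sFf] := smoothM_map sf.
rewrite -deriveE; last exact: (smooth_at_differentiable (sFf c' ac' cx')).
rewrite -(near_eq_derive v (near_chart_factor c' cf cx)) deriveE; last first.
  exact: differentiable_comp.
by rewrite diff_comp.
Qed.

(** The differential of [F \o f] factors through that of [f], so its injectivity in a single chart
    passes to [f] in every chart. *)
Lemma immersive_map V (f : V -> M) x c' : smoothM AM f x -> atlas AN c' ->
  cdom c' (F (f x)) -> injective ('d (c' \o F \o f) x) -> immersive AM f x.
Proof.
move=> sf ac' cx' inj c ac cx v w E; apply: inj.
by rewrite !(diff_chart_factor _ sf ac cx ac' cx') E.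
Qed.

End Maps.

Lemma injective_diffP V W (f : V -> W) x :
  injective ('d f x) <-> forall v, 'd f x v = 0 -> v = 0.
Proof.
split=> [inj v v0|H v w E]; first by apply: inj; rewrite v0 linear0.
by apply/eqP; rewrite -subr_eq0; apply/eqP/H; rewrite linearB E subrr.
Qed.

Lemma immersive_chart (m : nat) (M : topologicalType) (AM : manifold R m M)
    V (f : V -> M) x c : smoothM AM f x -> atlas AM c -> cdom c (f x) ->
  injective ('d (c \o f) x) -> immersive AM f x.
Proof.
move=> sf ac cx inj; exact (@immersive_map m m M M AM AM id (@smooth_map_id m M AM) V f x c sf ac cx inj).
Qed.

End ManifoldMaps.

(** * Topological embeddings and composition *)

Section Embeddings.
Variables X Y Z : topologicalType.

Lemma embeds_sub (f : X -> Y) (A B : set X) : B `<=` A -> embeds f A -> embeds f B.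
Proof.
move=> BA [inj H]; split=> [x y|O oO].
  by rewrite !inE => Bx By; apply: inj; rewrite inE; exact: BA.
have [D' oD' E] := H O oO; exists D' => //; rewrite eqEsubset; split=> y.
  case=> x [Bx Ox] <-; split; first by exists x.
  have [] // : (f @` A `&` D') (f x).
  by rewrite -E; exists x => //; split=> //; exact: BA.
case=> [[x Bx <-] Dx]; exists x => //; split=> //.
have [w [Aw Ow] wx] : (f @` (A `&` O)) (f x).
  by rewrite E; split=> //; exists x => //; exact: BA.
 rewrite -(inj w x) ?inE //; exact: BA.
Qed.

(** An open set witnessing the property for [g \o f] is pulled back along [g], which is continuous
    on the open set [D] containing the image. *)
Lemma embeds_postcomp (f : X -> Y) (g : Y -> Z) (A : set X) (D : set Y) :
  open D -> (forall y, D y -> {for y, continuous g}) -> f @` A `<=` D ->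
  embeds (g \o f) A -> embeds f A.
Proof.
move=> oD cg AD [inj H]; split=> [x y Ax Ay E|O oO].
  by apply: inj; rewrite //= E.
have [D' oD' E] := H O oO; exists (D `&` g @^-1` D').
  exact: open_preimage_on.
rewrite eqEsubset; split=> y.
  case=> x [Ax Ox] <-; split; first by exists x.
  split; first by apply: AD; exists x.
  have [] // : ((g \o f) @` A `&` D') (g (f x)) by rewrite -E; exists x.
case=> [[x Ax <-] [_ Dx]].
have [w [Aw Ow] /inj <-] : ((g \o f) @` (A `&` O)) (g (f x)); rewrite ?inE //.
  by rewrite E; split=> //; exists x.
by exists w.
Qed.

Lemma embeds_precomp (f : X -> Y) (g : Y -> Z) (A : set X) :
  open A -> (forall x, A x -> {for x, continuous f}) ->
  embeds (g \o f) A -> embeds g (f @` A).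
Proof.
move=> oA cf [inj H]; split=> [x y|O oO].
  rewrite !inE => -[a Aa <-] [b Ab <-] E; congr f.
  by apply: inj; rewrite ?inE.
have [D' oD' E] := H _ (open_preimage_on oA oO cf).
exists D' => //; rewrite eqEsubset; split=> y.
  case=> _ [[a Aa <-] Oa] <-; split; first by exists (f a) => //; exists a.
  have [] // : ((g \o f) @` A `&` D') (g (f a)) by rewrite -E; exists a.
case=> [[_ [a Aa <-] <-] Da].
have [b [Ab [_ Ob]] <-] : ((g \o f) @` (A `&` (A `&` f @^-1` O))) (g (f a)).
  by rewrite E; split=> //; exists a.
by exists (f b) => //; split=> //; exists b.
Qed.

Lemma embeds_comp (f : X -> Y) (g : Y -> Z) (A : set X) :
  embeds f A -> embeds g (f @` A) -> embeds (g \o f) A.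
Proof.
move=> [injf Hf] [injg Hg]; split=> [x y Ax Ay E|O oO].
  apply: injf => //; apply: injg; rewrite ?inE //.
    by exists x => //; rewrite -in_setE.
  by exists y => //; rewrite -in_setE.
have [D1 oD1 E1] := Hf O oO; have [D2 oD2 E2] := Hg D1 oD1.
by exists D2 => //; rewrite -(image_comp f g (A `&` O)) -(image_comp f g A) E1 E2.
Qed.

End Embeddings.

Lemma embeds_lower_lipschitz (R : realType) p q (g : 'rV[R]_p -> 'rV[R]_q)
    (A : set 'rV[R]_p) :
  (forall x y, A x -> A y -> `|x - y| <= 2 * `|g x - g y|) -> embeds g A.
Proof.
move=> H; split=> [x y|O oO].
  rewrite !inE => Ax Ay E; apply/eqP; rewrite -subr_eq0 -normr_le0.
  by apply: le_trans (H x y Ax Ay) _; rewrite E subrr normr0 mulr0.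
(* A union of balls around the points [g x]. If [g y] is within [e] of [g x], the bound places [y]
   within [2 * e] of [x], hence in [O]. *)
exists [set w | exists2 x, A x & exists2 e : R, 0 < e &
    ball x (2 * e) `<=` O /\ ball (g x) e w].
  rewrite openE => w [x Ax [e e0 [xO gw]]].
  have : nbhs w (ball (g x) e).
    apply: open_nbhs_nbhs; split=> //; exact: ball_open.
  by apply: filterS => w' gw'; exists x => //; exists e.
rewrite eqEsubset; split=> w.
  case=> x [Ax Ox] <-; split; first by exists x.
  have [r /= r0 rO] := (nbhs_ballP _ _).1 (open_nbhs_nbhs (conj oO Ox)).
  exists x => //; exists (r / 2); first by rewrite divr_gt0.
  by split; [rewrite mulrC divfK | apply: ballxx; rewrite divr_gt0].
case=> [[y Ay <-] [x Ax [e e0 [xO gw]]]]; exists y => //; split=> //.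
apply: xO; move: gw; rewrite -!ball_normE /= => gw.
by apply: le_lt_trans (H _ _ Ax Ay) _; rewrite ltr_pM2l.
Qed.

(** * Parametrizations of submanifolds *)

Section Parametrizations.
Variable R : realType.

Lemma diff_shift (V W : normedModType R) (f : V -> W) (a x v : V) :
  differentiable f (a + x) -> 'd (fun y => f (a + y)) x v = 'd f (a + x) v.
Proof.
move=> df.
have dA : differentiable (fun y => a + y) x.
  by apply: differentiableD; [exact: differentiable_cst|exact: ex_diff].
have dfA : differentiable (fun y => f (a + y)) x.
  exact: (differentiable_comp (g := f) dA df).
rewrite -(deriveE v df) -(deriveE v dfA).
by apply: (@derive_affine R V V W idfun a f x v) => // y.
Qed.

Section OneManifold.
Variables (m : nat) (M : topologicalType) (AM : manifold R m M) (p : nat).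
Implicit Types (S : set M) (z : M) (s t : 'rV[R]_p -> M).

Lemma local_paramP S z s : local_param AM S z s <-> s 0 = z /\
  exists (U : set 'rV[R]_p) (D : set M),
    [/\ open U, U 0, open D & s @` U = S `&` D] /\
    [/\ forall x, U x -> smoothM AM s x, embeds s U &
        forall x, U x -> immersive AM s x].
Proof.
split=> -[s0 [U [D]]].
  move=> [[oU U0] [oD E] sU eU iU]; split=> //; exists U, D; split=> //; split=> //.
    by rewrite -smooth_intoP.
  by move=> x Ux c ac cx; exact: iU.
move=> [[oU U0 oD E] [sU eU iU]]; split=> //; exists U, D; split=> //.
  by rewrite smooth_intoP.
by move=> x c Ux ac cx; exact: iU.
Qed.

Lemma local_param0 S z s : local_param AM S z s -> s 0 = z.
Proof. by case. Qed.

Lemma local_param_mem S z s : local_param AM S z s -> S z.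
Proof.
move=> /local_paramP[s0 [U [D [[_ U0 _ E] _]]]].
by have [] : (S `&` D) z by rewrite -E; exists 0.
Qed.

Lemma local_param_smooth S z s : local_param AM S z s ->
  \forall x \near (0 : 'rV[R]_p), smoothM AM s x.
Proof.
move=> /local_paramP[_ [U [D [[oU U0 _ _] [sU _ _]]]]].
by apply: filterS sU _; exact: (open_nbhs_nbhs (conj oU U0)).
Qed.

(** [h] is [s^-1 \o t], continuous because [s] is an embedding. For smoothness, a one-sided inverse
    [B] of the Jacobian of [s] at [h x] turns the chart expression of [s] into a map [F] between
    spaces of equal dimension with Jacobian 1, and [F \o h] is the smooth map [c \o t] followed by
    [B]. *)
Lemma transition (U V : set 'rV[R]_p) s t :
  open U -> (forall x, U x -> smoothM AM s x) -> (forall x, U x -> immersive AM s x) ->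
  embeds s U -> open V -> (forall x, V x -> smoothM AM t x) -> t @` V `<=` s @` U ->
  exists h : 'rV[R]_p -> 'rV[R]_p,
    forall x, V x -> [/\ U (h x), s (h x) = t x & smooth_at h x].
Proof.
move=> oU sU iU [injU eU] oV sV VU.
pose h x := xget (0 : 'rV[R]_p) [set y | U y /\ s y = t x].
have Hh x : V x -> U (h x) /\ s (h x) = t x.
  move=> Vx; have [y Uy E] := VU (t x) (ex_intro2 _ _ x Vx erefl).
  exact: (@xgetPex _ 0 [set y | U y /\ s y = t x] (ex_intro _ y (conj Uy E))).
have ch x : V x -> {for x, continuous h}.
  move=> Vx B; rewrite nbhsE => -[D [oD Dx] DB].
  have [Uhx sx] := Hh x Vx; have [D' oD' E] := eU D oD.
  have D'x : D' (t x).
    by have [] // : (s @` U `&` D') (t x); rewrite -E -sx; exists (h x).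
  have nD : \forall y \near x, D' (t y).
    by apply: (proj1 (sV x Vx)); exact: (open_nbhs_nbhs (conj oD' D'x)).
  rewrite /= nbhs_simpl; apply: filterS2 nD (open_nbhs_nbhs (conj oV Vx)) => y D'y Vy.
  have [Uhy sy] := Hh y Vy; apply: DB.
  have [w [Uw Dw] E'] : (s @` (U `&` D)) (t y).
    by rewrite E -sy; split; [exists (h y)|rewrite sy].
  by rewrite -(injU w (h y)) ?inE // sy.
exists h => x Vx; have [Uhx sx] := Hh x Vx; split=> //.
have [c ac cx] := atlas_cover AM (s (h x)).
have ctx : cdom c (t x) by rewrite -sx.
set phi := c \o s.
have sphi : smooth_at phi (h x) by apply: (sU _ Uhx).2.
have dphi := smooth_at_differentiable sphi.
have free : row_free (derive_mxf phi (h x)).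
  apply: inj_row_free => v; rewrite -derive_mxfE // deriveE // => v0.
  by apply: (iU _ Uhx c ac cx); rewrite v0 linear0.
set B := pinvmx (derive_mxf phi (h x)).
have cB : continuous (mulmxr B : 'rV[R]_m -> 'rV[R]_p).
  exact: (linear_mx_continuous (L := mulmxr B)).
pose F := mulmxr B \o phi : 'rV[R]_p -> 'rV[R]_p.
have sF : smooth_at F (h x) := smooth_at_linear_comp cB sphi.
have dF : derive_mxf F (h x) = 1%:M.
  rewrite -(mulmxVp free); apply/matrixP => i j; rewrite mxE.
  rewrite /F (derive_linear_comp _ cB dphi) /= derive_mxfE // -rowE.
  by rewrite -row_mul mxE.
apply: (@smooth_at_left_inverse R _ p F h x sF); first by rewrite dF unitmx1.
  by apply: filterS (open_nbhs_nbhs (conj oV Vx)) => y; exact: ch.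
have sct : smooth_at (mulmxr B \o (c \o t)) x.
  by apply: smooth_at_linear_comp => //; apply: (sV x Vx).2.
apply: smooth_at_near sct; apply: filterS (open_nbhs_nbhs (conj oV Vx)) => y Vy.
by have [_ sy] := Hh y Vy; rewrite /F /phi /= sy.
Qed.

End OneManifold.

Section Reparametrization.
Variables (m : nat) (M : topologicalType) (AM : manifold R m M) (p : nat).
Implicit Types (S : set M) (z : M) (s t : 'rV[R]_p -> M).

Lemma derive_comp_inj q n (f : 'rV[R]_n -> 'rV[R]_q) (h : 'rV[R]_p -> 'rV[R]_n) x :
  differentiable h x -> differentiable f (h x) ->
  injective ('d (f \o h) x) <-> injective ('d f (h x) \o 'd h x).
Proof. by move=> dh df; rewrite diff_comp. Qed.

(** The last clause speaks of any submanifold of any manifold: that [h] is open, injective and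
    immersive does not depend on [S]. The same [h] can thus be applied to both parametrizations of a
    contact. *)
Lemma reparam S z s t : local_param AM S z s -> local_param AM S z t ->
  exists h : 'rV[R]_p -> 'rV[R]_p, [/\ h 0 = 0, smooth_at h 0,
    {near (0 : 'rV[R]_p), s \o h =1 t} &
    forall m' (M' : topologicalType) (AM' : manifold R m' M') (S' : set M') (z' : M')
        (s' : 'rV[R]_p -> M'),
      local_param AM' S' z' s' -> local_param AM' S' z' (s' \o h)].
Proof.
move=> /local_paramP[s0 [U [D [[oU U0 oD E] [sU eU iU]]]]].
move=> /local_paramP[t0 [V [Q [[oV V0 oQ F] [sV eV iV]]]]].
have Sz : (S `&` D) z by rewrite -E -s0; exists 0.
pose V1 := V `&` t @^-1` D.
have oV1 : open V1 by apply: open_preimage_on => // x Vx; exact: (proj1 (sV x Vx)).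
have V10 : V1 0 by split=> //=; rewrite t0; exact: Sz.2.
have V1U : t @` V1 `<=` s @` U.
  move=> _ [x [Vx Dx] <-]; rewrite E; split=> //.
  by have [] : (S `&` Q) (t x) by rewrite -F; exists x.
have [h Hh] := transition oU sU iU eU oV1 (fun x Vx => sV x Vx.1) V1U.
have h0 : h 0 = 0.
  have [Uh sh _] := Hh 0 V10; apply: eU.1; rewrite ?inE //.
  by rewrite sh t0 s0.
have ch x : V1 x -> {for x, continuous h}.
  by move=> /Hh[_ _]; exact: smooth_at_continuous.
have injh : set_inj V1 h.
  move=> x y; rewrite !inE => Vx Vy hxy; apply: eV.1; rewrite ?inE; [exact: Vx.1|exact: Vy.1|].
  by have [_ <- _] := Hh x Vx; have [_ <- _] := Hh y Vy; rewrite hxy.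
(* Openness of [h] comes from the two embeddings: [t] maps [W] onto a relatively open part of [S],
   whose preimage by [s] is the image of [W] under [h]. *)
have oh W : open W -> W `<=` V1 -> open (h @` W).
  move=> oW WV1; have [D' oD' E'] := eV.2 W oW.
  have -> : h @` W = U `&` s @^-1` (Q `&` D').
    rewrite eqEsubset; split=> u.
      case=> w Ww <-; have Vw := WV1 _ Ww; have [Uhw sw _] := Hh w Vw.
      split=> //=; rewrite sw.
      have [tV D'w] : (t @` V `&` D') (t w).
        by rewrite -E'; exists w => //; split=> //; exact: Vw.1.
      by split=> //; move: tV; rewrite F => -[].
    case=> Uu [/= Qu D'u].
    have [Su _] : (S `&` D) (s u) by rewrite -E; exists u.
    have [w [Vw Ww] tw] : (t @` (V `&` W)) (s u) by rewrite E' F.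
    exists w => //; have [Uhw sw _] := Hh w (WV1 w Ww).
    by apply: eU.1; rewrite ?inE // sw.
  by apply: open_preimage_on => //; [exact: openI|move=> x Ux; exact: (proj1 (sU x Ux))].
have inj_dh x : V1 x -> differentiable h x /\ injective ('d h x).
  move=> Vx; have [Uhx shx sh] := Hh x Vx; have dh := smooth_at_differentiable sh.
  split=> //; have [c ac cx] := atlas_cover AM (t x).
  apply/injective_diffP => v hv.
  have inj := iV x Vx.1 c ac cx; apply: inj; rewrite linear0.
  have cshx : cdom c (s (h x)) by rewrite shx.
  have dcs := smooth_at_differentiable ((sU _ Uhx).2 c ac cshx).
  have dct := smooth_at_differentiable ((sV _ Vx.1).2 c ac cx).
  rewrite -deriveE //.
  have nst : {near x, (c \o s) \o h =1 c \o t}.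
    by apply: filterS (open_nbhs_nbhs (conj oV1 Vx)) => y /Hh[_ /= -> _].
  rewrite -(near_eq_derive v nst) deriveE; last exact: differentiable_comp.
  by rewrite diff_comp //= hv linear0.
exists h; split=> //.
- by have [] := Hh 0 V10.
- by apply: filterS (open_nbhs_nbhs (conj oV1 V10)) => y /Hh[_ /= -> _].
move=> m' M' AM' S' z' s' /local_paramP[s'0 [U' [D' [[oU' U'0 oD' E'] [sU' eU' iU']]]]].
pose W := V1 `&` h @^-1` U'.
have oW : open W by exact: open_preimage_on.
have WV1 : W `<=` V1 by move=> x [].
have hWU' : h @` W `<=` U' by move=> _ [x [_ U'x] <-].
have [D2 oD2 E2] := eU'.2 _ (oh W oW WV1).
apply/local_paramP; split; first by rewrite /= h0.
exists W, (D' `&` D2); split; split.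
- exact: oW.
- by split=> //=; rewrite h0.
- exact: openI.
- by rewrite -(image_comp h s' W) -{1}(setIidr hWU') E2 E' setIA.
- move=> x [Vx U'x]; have [_ _ sh] := Hh x Vx.
  exact: (smoothM_comp sh (sU' _ U'x)).
- apply: embeds_comp; last exact: embeds_sub eU'.
  split=> [x y|A oA].
    rewrite !inE => Wx Wy; apply: injh; rewrite inE; exact: WV1.
  exists (h @` (W `&` A)).
    by apply: oh => [|x [/WV1]]; first exact: openI.
  rewrite eqEsubset; split=> u; last by case.
  by case=> x [Wx Ax] <-; split; [exists x|exists x].
- move=> x [Vx U'x] c ac cx; have [dh ih] := inj_dh x Vx.
  have dcs := smooth_at_differentiable ((sU' _ U'x).2 c ac cx).
  have -> : c \o (s' \o h) = (c \o s') \o h by [].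
  apply/derive_comp_inj => //; apply: inj_comp => //; exact: (iU' _ U'x c ac cx).
Qed.

(** Parametrizations are centered at 0 by definition; translating the parameter recenters them at
    the other points of their domain, so that facts proved at 0 hold on a neighborhood. *)
Lemma translate_in S s (U : set 'rV[R]_p) (D : set M) x :
  open U -> open D -> s @` U = S `&` D -> (forall x, U x -> smoothM AM s x) ->
  embeds s U -> (forall x, U x -> immersive AM s x) -> U x ->
  local_param AM S (s x) (fun y => s (x + y)).
Proof.
move=> oU oD E sU eU iU Ux.
have cT : forall y : 'rV[R]_p, {for y, continuous (fun y => x + y)}.
  move=> y; apply: smooth_at_continuous.
  by apply: smooth_atD; [exact: smooth_at_cst|exact: smooth_at_id].
pose U' := (fun y => x + y) @^-1` U.
have oU' : open U' by apply: (open_comp _ oU) => y _; exact: cT.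
have UU' : (fun y => x + y) @` U' = U.
  rewrite eqEsubset; split=> u; first by case=> y U'y <-.
  by move=> Uu; exists (u - x); rewrite /U' /= addrC subrK.
apply/local_paramP; split; first by rewrite addr0.
exists U', D; split; split=> //.
- by rewrite /U' /= addr0.
- by rewrite -E -[in RHS]UU' image_comp.
- by move=> y U'y; apply: smoothM_shift; exact: sU.
- apply: (@embeds_comp _ _ _ (fun y => x + y) s); last by rewrite UU'.
  split=> [a b _ _ /addrI //|A oA].
  exists ((fun y => y - x) @^-1` A).
    apply: (open_comp _ oA) => y _; apply: smooth_at_continuous.
    by apply: smooth_atD; [exact: smooth_at_id|exact: smooth_at_cst].
  rewrite eqEsubset; split=> u.
    by case=> y [U'y Ay] <-; split; [exists y|rewrite /= addrC addrA addNr add0r].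
  by case=> -[y U'y <-]; rewrite /= addrC addrA addNr add0r => Ay; exists y.
- move=> y U'y c ac cy.
  have dcs := smooth_at_differentiable ((sU _ U'y).2 c ac cy).
  move=> v w E'; apply: (iU _ U'y c ac cy).
  by rewrite -[LHS](diff_shift v dcs) -[RHS](diff_shift w dcs).
Qed.

Lemma translate S z s : local_param AM S z s ->
  \forall x \near (0 : 'rV[R]_p), local_param AM S (s x) (fun y => s (x + y)).
Proof.
move=> /local_paramP[s0 [U [D [[oU U0 oD E] [sU eU iU]]]]].
by apply: filterS (open_nbhs_nbhs (conj oU U0)) => x Ux; exact: translate_in E _ _ _ _.
Qed.

End Reparametrization.
End Parametrizations.

(** * Jets and their projections *)

Section Velocities.
Variables (R : realType) (p k : nat).

Lemma velocity_near (m : nat) (M : topologicalType) (c : chart R m M)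
    (f g : 'rV[R]_p -> M) :
  {near (0 : 'rV[R]_p), f =1 g} -> velocity k c f = velocity k c g.
Proof.
move=> fg; apply/matrixP => i a; rewrite !mxE.
have cfg : {near (0 : 'rV[R]_p), c \o f =1 c \o g} by apply: filterS fg => y /= ->.
by rewrite /partial_derive (nbhs_singleton (near_iter_derive _ cfg)).
Qed.

Section OneManifold.
Variables (m : nat) (M : topologicalType) (AM : manifold R m M).
Implicit Types (c : chart R m M) (f g : 'rV[R]_p -> M).

Lemma near_smooth_on_chart f c :
  (\forall x \near (0 : 'rV[R]_p), smoothM AM f x) -> atlas AM c -> cdom c (f 0) ->
  \forall x \near (0 : 'rV[R]_p), smooth_at (c \o f) x.
Proof.
move=> sf ac c0; have [cf _] := nbhs_singleton sf.
by apply: filterS2 sf (near_continuous_cdom cf c0) => x [_ +] cx; apply.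
Qed.

Lemma velocityP f g c :
  (\forall x \near (0 : 'rV[R]_p), smoothM AM f x) ->
  (\forall x \near (0 : 'rV[R]_p), smoothM AM g x) ->
  atlas AM c -> cdom c (f 0) -> cdom c (g 0) ->
  velocity k c f = velocity k c g <-> agree k (c \o f) (c \o g) 0.
Proof.
move=> sf sg ac cf cg.
have : nbhs (0 : 'rV[R]_p) [set x | smooth_at (c \o f) x /\ smooth_at (c \o g) x].
  exact: filterI (near_smooth_on_chart sf ac cf) (near_smooth_on_chart sg ac cg).
rewrite nbhsE => -[U [oU U0] UH].
by apply: (@velocity_agree R m M p k c c U) => //;
  rewrite smooth_onP // => x /UH[].
Qed.

Lemma velocity_base f g c :
  (\forall x \near (0 : 'rV[R]_p), smoothM AM f x) ->
  (\forall x \near (0 : 'rV[R]_p), smoothM AM g x) ->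
  atlas AM c -> cdom c (f 0) -> cdom c (g 0) ->
  velocity k c f = velocity k c g -> f 0 = g 0.
Proof.
move=> sf sg ac cf cg /(velocityP sf sg ac cf cg)/agree0 /= E.
by rewrite -(cmapK cf) E cmapK.
Qed.

Lemma velocity_precomp f g c (h : 'rV[R]_p -> 'rV[R]_p) :
  (\forall x \near (0 : 'rV[R]_p), smoothM AM f x) ->
  (\forall x \near (0 : 'rV[R]_p), smoothM AM g x) ->
  (\forall x \near (0 : 'rV[R]_p), smoothM AM (f \o h) x) ->
  (\forall x \near (0 : 'rV[R]_p), smoothM AM (g \o h) x) ->
  atlas AM c -> cdom c (f 0) -> cdom c (g 0) ->
  h 0 = 0 -> smooth_at h 0 ->
  velocity k c f = velocity k c g -> velocity k c (f \o h) = velocity k c (g \o h).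
Proof.
move=> sf sg sfh sgh ac cf cg h0 sh E.
have cfh : cdom c ((f \o h) 0) by rewrite /= h0.
have cgh : cdom c ((g \o h) 0) by rewrite /= h0.
apply/(velocityP sfh sgh ac cfh cgh).
move/(velocityP sf sg ac cf cg) : E => E.
apply: (@agree_comp R p p 1 m k h h (c \o f) (c \o g)) => //; rewrite ?h0 //.
- exact: (nbhs_singleton (near_smooth_on_chart sf ac cf)).
- exact: (nbhs_singleton (near_smooth_on_chart sg ac cg)).
- exact: agree_refl.
Qed.

End OneManifold.

Lemma velocity_map (m n : nat) (M N : topologicalType) (AM : manifold R m M)
    (AN : manifold R n N) (F : M -> N) (f g : 'rV[R]_p -> M) c c' :
  smooth_map AM AN F ->
  (\forall x \near (0 : 'rV[R]_p), smoothM AM f x) ->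
  (\forall x \near (0 : 'rV[R]_p), smoothM AM g x) ->
  atlas AM c -> cdom c (f 0) -> cdom c (g 0) -> atlas AN c' -> cdom c' (F (f 0)) ->
  velocity k c f = velocity k c g -> velocity k c' (F \o f) = velocity k c' (F \o g).
Proof.
move=> sF sf sg ac cf cg ac' c'f E.
have fg0 := velocity_base sf sg ac cf cg E.
have sFf : \forall x \near (0 : 'rV[R]_p), smoothM AN (F \o f) x.
  by apply: filterS sf => x; exact: smoothM_map.
have sFg : \forall x \near (0 : 'rV[R]_p), smoothM AN (F \o g) x.
  by apply: filterS sg => x; exact: smoothM_map.
have c'g : cdom c' (F (g 0)) by rewrite -fg0.
apply/(velocityP sFf sFg ac' c'f c'g).
move/(velocityP sf sg ac cf cg) : E => E.
have [cof _] := nbhs_singleton sf; have [cog _] := nbhs_singleton sg.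
apply: near_agree (near_chart_factor F c' cof cf) (near_chart_factor F c' cog cg) _.
apply: agree_comp => //.
- exact: (nbhs_singleton (near_smooth_on_chart sf ac cf)).
- exact: (nbhs_singleton (near_smooth_on_chart sg ac cg)).
- exact: (smooth_map_at sF ac cf ac' c'f).
- exact: (smooth_map_at sF ac cf ac' c'f).
- exact: agree_refl.
Qed.

End Velocities.

Lemma local_param_shrink (R : realType) (p m : nat) (M : topologicalType)
    (AM : manifold R m M) (S : set M) (z : M) (s : 'rV[R]_p -> M) (W : set 'rV[R]_p) :
  local_param AM S z s -> nbhs (0 : 'rV[R]_p) W ->
  exists (V : set 'rV[R]_p) (D : set M),
    ([/\ open V, V 0, open D & s @` V = S `&` D] /\
     [/\ forall x, V x -> smoothM AM s x, embeds s V &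
        forall x, V x -> immersive AM s x]) /\ V `<=` W.
Proof.
move=> /local_paramP[s0 [U [D [[oU U0 oD E] [sU eU iU]]]]].
rewrite nbhsE => -[B [oB B0] BW].
have [D' oD' E'] := eU.2 B oB.
have UBU : U `&` B `<=` U by move=> x [].
exists (U `&` B), (D `&` D'); split; last by move=> x [_ /BW].
split; split.
- exact: openI.
- by [].
- exact: openI.
- by rewrite E' E setIA.
- by move=> x [Ux _]; exact: sU.
- exact: embeds_sub eU.
- by move=> x [Ux _]; exact: iU.
Qed.

(** * Contact as an equivalence relation; independence of representatives *)

Section Jets.
Variables (R : realType) (p k : nat).

Section OneManifold.
Variables (m : nat) (M : topologicalType) (AM : manifold R m M).
Implicit Types (c : chart R m M) (S T : set M) (z : M) (s t : 'rV[R]_p -> M).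

(** One chart is enough, since changing the chart is [velocity_map] for the identity of [M]. *)
Lemma contact_of_velocity S T z s t c :
  local_param AM S z s -> local_param AM T z t -> atlas AM c -> cdom c z ->
  velocity k c s = velocity k c t -> contact AM p k z S T.
Proof.
move=> ls lt ac cz E; exists s, t; split=> // c' ac' cz'.
have [s0 t0] := (local_param0 ls, local_param0 lt).
apply: (@velocity_map R p k m m M M AM AM id s t c c' (@smooth_map_id R m M AM)
  (local_param_smooth ls) (local_param_smooth lt) ac _ _ ac' _ E);
by rewrite ?s0 ?t0.
Qed.

Lemma contact_refl S z : submanifold AM p S -> S z -> contact AM p k z S S.
Proof. by move=> sS Sz; have [s ls] := sS z Sz; exists s, s. Qed.

Lemma contact_sym S T z : contact AM p k z S T -> contact AM p k z T S.
Proof. by move=> [s [t [ls lt H]]]; exists t, s; split=> // c ac cz; rewrite H. Qed.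

(** Contact provides only some pair of parametrizations. Composing the second with the change of
    parameter from the first to [s] gives a partner for a prescribed [s]; transitivity of contact
    rests on this. *)
Lemma contact_lift S T z s : contact AM p k z S T -> local_param AM S z s ->
  exists2 t, local_param AM T z t & forall c, atlas AM c -> cdom c z ->
    velocity k c s = velocity k c t.
Proof.
move=> [s1 [t1 [ls1 lt1 E]]] ls.
have [h [h0 sh nst H]] := reparam ls1 ls.
have lsh := H _ _ _ _ _ _ ls1; have lth := H _ _ _ _ _ _ lt1.
exists (t1 \o h) => // c ac cz; rewrite -(velocity_near k c nst).
apply: (@velocity_precomp R p k m M AM) => //; try exact: local_param_smooth; try exact: E.
- exact: local_param_smooth ls1.
- exact: local_param_smooth lt1.
- exact: local_param_smooth lsh.
- exact: local_param_smooth lth.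
- by rewrite (local_param0 ls1).
- by rewrite (local_param0 lt1).
Qed.

Lemma contact_trans S T T' z :
  contact AM p k z S T -> contact AM p k z T T' -> contact AM p k z S T'.
Proof.
move=> [s [t [ls lt E]]] CT; have [t' lt' E'] := contact_lift CT lt.
by exists s, t'; split=> // c ac cz; rewrite E // E'.
Qed.

Lemma jet_contact S T z : contact AM p k z S T -> jet AM p k z S = jet AM p k z T.
Proof.
move=> C; rewrite eqEsubset; split=> y [yz sy Cy]; split=> //.
  exact: contact_trans (contact_sym C) Cy.
exact: contact_trans C Cy.
Qed.

Lemma jet_eq S T z w : submanifold AM p T -> T w ->
  jet AM p k z S = jet AM p k w T -> z = w /\ contact AM p k z S T.
Proof.
move=> sT Tw E; have [/= wz _ C] : jet AM p k z S (w, T).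
  by rewrite E; split=> //; exact: contact_refl.
by rewrite wz.
Qed.

(** The entry of order 0 fixes the base point, the others the contact class. Functions of jets can
    therefore be read in coordinates by choosing any jet of velocity [w]. *)
Lemma jet_velocity_uniq c (w : 'M[R]_(#|multi_index p k|, m)) j j' : atlas AM c ->
  jet_velocity AM c w j -> jet_velocity AM c w j' -> j = j' :> jet_of M.
Proof.
move=> ac [z [S [s [cz sS ls -> ->]]]] [z' [S' [s' [cz' sS' ls' E ->]]]].
have [s0 s'0] := (local_param0 ls, local_param0 ls').
have zz : z = z'.
  rewrite -s0 -s'0; apply: (velocity_base (local_param_smooth ls)
    (local_param_smooth ls') ac _ _ E); by rewrite ?s0 ?s'0.
rewrite -zz in ls' *; apply: jet_contact.
exact: (contact_of_velocity ls ls' ac cz E).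
Qed.

End OneManifold.

Section Projection.
Variables (m n : nat) (M N : topologicalType).
Variables (AM : manifold R m M) (AN : manifold R n N) (F : M -> N).
Hypothesis sF : smooth_map AM AN F.
Implicit Types (S T : set M) (z : M) (s t : 'rV[R]_p -> M).

Lemma regular_immersive S z s : regular AM AN p F S -> local_param AM S z s ->
  immersive AN (F \o s) 0.
Proof.
move=> rS ls c' ac' cx'; have s0 := local_param0 ls.
have [c ac cz] := atlas_cover AM z.
have ss := nbhs_singleton (local_param_smooth ls).
have /local_paramP[_ [U [D [[oU U0 _ _] [_ _ iU]]]]] := ls.
have cz0 : cdom c (s 0) by rewrite s0.
have cx'0 : cdom c' (F z) by rewrite -s0.
apply/injective_diffP => v.
have -> : c' \o (F \o s) = c' \o F \o s by [].
rewrite (diff_chart_factor sF v ss ac cz0 ac' cx') s0 => H.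
have w0 : 'd (c \o s) 0 v = 0.
  apply: (rS z c c' (local_param_mem ls) ac cz ac' cx'0 _ _ H).
  by exists s, v.
by apply: (iU 0 U0 c ac cz0); rewrite w0 linear0.
Qed.

(** [regular_immersive] only speaks of the parameter 0; the domain is shrunk so that [translate]
    brings each of its points to 0. The image is cut out by an open set of [N] because [F] embeds
    [S]. *)
Lemma local_param_image S z s : regular AM AN p F S -> embeds F S ->
  local_param AM S z s -> local_param AN (F @` S) (F z) (F \o s).
Proof.
move=> rS eS ls.
have [V [D [[[oV V0 oD E] [sV eV iV]] VT]]] := local_param_shrink ls (translate ls).
have [D' oD' E'] := eS.2 D oD.
apply/local_paramP; split; first by rewrite /= (local_param0 ls).
exists V, D'; split; split=> //.
- by rewrite -(image_comp s F V) E E'.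
- by move=> x Vx; exact: (smoothM_map sF (sV x Vx)).
- apply: embeds_comp => //; apply: embeds_sub eS.
  by rewrite E => z' [].
move=> x Vx c' ac' cx'.
have lx := VT x Vx; have := regular_immersive rS lx ac'.
rewrite /= addr0 => /(_ cx') inj v w E2; apply: inj.
have [_ sFs] := smoothM_map sF (sV x Vx).
have dx : differentiable (c' \o (F \o s)) (x + 0).
  by rewrite addr0; exact: (smooth_at_differentiable (sFs c' ac' cx')).
rewrite [LHS](diff_shift v dx) [RHS](diff_shift w dx) addr0.
exact: E2.
Qed.

Lemma submanifold_image S : submanifold AM p S -> regular AM AN p F S -> embeds F S ->
  submanifold AN p (F @` S).
Proof.
move=> sS rS eS _ [z Sz <-]; have [s ls] := sS z Sz.
by exists (F \o s); exact: local_param_image.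
Qed.

Lemma contact_image S T z :
  regular AM AN p F S -> embeds F S -> regular AM AN p F T -> embeds F T ->
  contact AM p k z S T -> contact AN p k (F z) (F @` S) (F @` T).
Proof.
move=> rS eS rT eT [s [t [ls lt H]]]; have [c ac cz] := atlas_cover AM z.
exists (F \o s), (F \o t); split; [exact: local_param_image|exact: local_param_image|].
have [s0 t0] := (local_param0 ls, local_param0 lt).
move=> c' ac' c'z.
apply: (velocity_map sF (local_param_smooth ls) (local_param_smooth lt) ac _ _ ac' _ (H c ac cz));
  by rewrite ?s0 ?t0.
Qed.

(** The value picked by [xget] comes from some [T] in contact with [S] at [z], and [contact_image]
    shows that it does not depend on this [T]. *)
Lemma jet_projectionE S z : submanifold AM p S -> S z -> regular AM AN p F S ->
  embeds F S ->
  jet_projection AM AN p k F (jet AM p k z S) = jet AN p k (F z) (F @` S).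
Proof.
move=> sS Sz rS eS; rewrite /jet_projection; case: xgetP => [j' _|]; last first.
  by move=> /(_ (jet AN p k (F z) (F @` S))); case; exists z, S.
move=> [w [T [[sT Tw] rT eT E ->]]].
have [zw C] := jet_eq sT Tw E.
by rewrite -zw; apply/esym/jet_contact; exact: contact_image.
Qed.

End Projection.
End Jets.

Lemma near_diff (R : realType) (V W : normedModType R) (f g : V -> W) (x v : V) :
  {near x, f =1 g} -> differentiable f x -> 'd f x v = 'd g x v.
Proof.
move=> fg df; rewrite -(deriveE v df) -(deriveE v (near_differentiable fg df)).
exact: near_eq_derive.
Qed.

Lemma diff_compE (R : realType) (V W X : normedModType R) (f : V -> W) (g : W -> X) x v :
  differentiable f x -> differentiable g (f x) ->
  'd (g \o f) x v = 'd g (f x) ('d f x v).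
Proof. by move=> df dg; rewrite diff_comp. Qed.

(** * Small patches that are regular and embedded by the projection *)

Section RegularPatch.
Variables (R : realType) (p m n : nat) (M N : topologicalType).
Variables (AM : manifold R m M) (AN : manifold R n N) (F : M -> N).
Hypothesis sF : smooth_map AM AN F.

(** [tangent] ranges over all parametrizations at [z], but any two differ by a change of parameter,
    whose differential carries the condition from one to the other; testing one per point
    suffices. *)
Lemma regular_of_params (S : set M) :
  (forall z, S z -> exists2 s : 'rV[R]_p -> M, local_param AM S z s &
     immersive AN (F \o s) 0) -> regular AM AN p F S.
Proof.
move=> H z c c' Sz ac cz ac' cz' w [t [v [lt ->]]] dw.
have [s ls iFs] := H z Sz; have [s0 t0] := (local_param0 ls, local_param0 lt).
have [h [h0 sh nst _]] := reparam ls lt.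
have ss := nbhs_singleton (local_param_smooth ls).
have cs0 : cdom c (s 0) by rewrite s0.
have dh := smooth_at_differentiable sh.
have dcs : differentiable (c \o s) (h 0).
  by rewrite h0; exact: (smooth_at_differentiable (ss.2 c ac cs0)).
have cz's : cdom c' (F (s 0)) by rewrite s0.
have tE : 'd (c \o t) 0 v = 'd (c \o s) 0 ('d h 0 v).
  have ncst : {near (0 : 'rV[R]_p), (c \o s) \o h =1 c \o t}.
    by apply: filterS nst => y /= ->.
  have dcsh : differentiable ((c \o s) \o h) 0 by exact: differentiable_comp.
  rewrite -[LHS](near_diff v ncst dcsh).
  rewrite [LHS](diff_compE v dh dcs).
  by rewrite h0.
have h'0 : 'd h 0 v = 0.
  apply: (iFs c' ac' cz's); rewrite linear0.
  by rewrite -dw tE [LHS](diff_chart_factor sF _ ss ac cs0 ac' cz's) s0.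
by rewrite tE h'0 linear0.
Qed.


(* [g := L o c' o F o s], with [L] a left inverse of the differential at 0, is
   close to the identity, hence expanding up to a factor 2 near 0; every
   injectivity and embedding statement is pulled back from [g]. *)
Lemma regular_patch (s : 'rV[R]_p -> M) (c' : chart R n N) :
  (\forall x \near (0 : 'rV[R]_p), smoothM AM s x) -> atlas AN c' ->
  cdom c' (F (s 0)) -> injective ('d (c' \o F \o s) 0) ->
  exists2 B0 : set 'rV[R]_p, nbhs (0 : 'rV[R]_p) B0 &
    forall B, open B -> B `<=` B0 -> B 0 ->
    [/\ submanifold AM p (s @` B), regular AM AN p F (s @` B),
        embeds F (s @` B) & local_param AM (s @` B) (s 0) s].
Proof.
move=> ss ac' c'0 inj0; set phi := c' \o F \o s.
have ss0 := nbhs_singleton ss.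
have [cFs sFs] := smoothM_map sF ss0.
have sphi : smooth_at phi 0 by exact: sFs.
have dphi := smooth_at_differentiable sphi.
have free : row_free (derive_mxf phi 0).
  apply: inj_row_free => v; rewrite -derive_mxfE // deriveE // => v0.
  by apply: inj0; rewrite v0 linear0.
set L := pinvmx (derive_mxf phi 0).
have cL : continuous (mulmxr L : 'rV[R]_n -> 'rV[R]_p).
  exact: (linear_mx_continuous (L := mulmxr L)).
pose g := mulmxr L \o phi : 'rV[R]_p -> 'rV[R]_p.
have sg : smooth_at g 0 := smooth_at_linear_comp cL sphi.
have dg : derive_mxf g 0 = 1%:M.
  rewrite -(mulmxVp free); apply/matrixP => i j; rewrite mxE.
  rewrite /g (derive_linear_comp _ cL dphi) /= derive_mxfE // -rowE.
  by rewrite -row_mul mxE.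
have [r r0 [lip injg]] := lower_lipschitz sg dg.
exists [set x | [/\ ball 0 r x, smoothM AM s x & cdom c' (F (s x))]].
  apply: filterS3 (nbhsx_ballx (0 : 'rV[R]_p) r r0) ss
    (near_continuous_cdom cFs c'0) => x; exact: And3.
move=> B oB BB0 B_0.
have eg : embeds g B.
  by apply: embeds_lower_lipschitz => x y /BB0[bx _ _] /BB0[by_ _ _]; exact: lip.
have eFs : embeds (F \o s) B.
  apply: (@embeds_postcomp _ _ _ (F \o s) (mulmxr L \o c') B (cdom c')
    (@cdom_open _ _ _ c') _ _ eg).
  - move=> y cy; apply: continuous_comp; first exact: cmap_continuous.
    exact: cL.
  - by move=> _ [x /BB0[_ _ ?] <-].
have es : embeds s B.
  apply: (@embeds_postcomp _ _ _ s F B setT openT _ _ eFs) => // y _.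
  exact: (smooth_map_continuous sF).
have iF x : B x -> injective ('d (c' \o F \o s) x).
  move=> Bx; have [bx sx c'x] := BB0 x Bx; have [dgx ig] := injg x bx.
  have dpx : differentiable phi x.
    have [_ sFx] := smoothM_map sF sx.
    exact: (smooth_at_differentiable (sFx c' ac' c'x)).
  have gE v : 'd g x v = 'd phi x v *m L.
    by rewrite -(deriveE v dgx) (derive_linear_comp v cL dpx) (deriveE v dpx).
  by move=> v w E; apply: ig; rewrite [LHS]gE [RHS]gE; congr (_ *m _); exact: E.
have sB x : B x -> smoothM AM s x by move=> /BB0[].
have iB x : B x -> immersive AM s x.
  move=> Bx; have [bx sx c'x] := BB0 x Bx.
  by apply: (immersive_map sF sx ac' c'x); exact: iF.
(* The patch is a submanifold on its own, parametrized globally by [B], so the ambient open set can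
   be everything. *)
have ET : s @` B = s @` B `&` setT by rewrite setIT.
have ls : local_param AM (s @` B) (s 0) s.
  apply/local_paramP; split=> //; exists B, setT; split; split=> //.
  exact: openT.
have lt x : B x -> local_param AM (s @` B) (s x) (fun y => s (x + y)).
  by move=> Bx; apply: (translate_in oB openT ET).
split=> //.
- by move=> _ [x Bx <-]; exists (fun y => s (x + y)); exact: lt.
- apply: regular_of_params => _ [x Bx <-]; exists (fun y => s (x + y)); first exact: lt.
  have [bx sx c'x] := BB0 x Bx; have sFx := smoothM_map sF sx.
  have dx : differentiable (c' \o (F \o s)) (x + 0).
    by rewrite addr0; exact: (smooth_at_differentiable (sFx.2 c' ac' c'x)).
  have sFx0 : smoothM AN (F \o (fun y => s (x + y))) 0.
    have sx0 : smoothM AM s (x + 0) by rewrite addr0.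
    exact: (smoothM_map sF (smoothM_shift sx0)).
  have c'x0 : cdom c' (F (s (x + 0))) by rewrite addr0.
  apply: (immersive_chart sFx0 ac' c'x0) => v w E; apply: (iF x Bx).
  have := diff_shift v dx; have := diff_shift w dx; rewrite addr0 => ew ev.
  by rewrite -[LHS]ev -[RHS]ew; exact: E.
- exact: (@embeds_precomp _ _ _ s F B oB (fun x Bx => (sB x Bx).1) eFs).
Qed.

End RegularPatch.

(** * Deformation of jets *)

Section Monomials.
Variable R : realType.

Lemma iter_derive_affine (V W X : normedModType R) (L : {linear V -> W}) (a : W)
    (g : W -> X) (U : set W) (vs : seq V) : continuous L -> open U ->
  (forall u, U u -> smooth_at g u) -> forall x, U (a + L x) ->
  iter_derive vs (fun y => g (a + L y)) x = iter_derive (map L vs) g (a + L x).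
Proof.
move=> cL oU sg.
have cA x : (fun y => a + L y) y @[y --> x] --> a + L x.
  by apply: cvgD; [exact: cvg_cst | exact: cL].
elim: vs => //= v vs IH x Ux.
have nU : \forall y \near x, U (a + L y).
  by apply: (cA x); exact: (open_nbhs_nbhs (conj oU Ux)).
have nE : {near x, iter_derive vs (fun y => g (a + L y)) =1
                   fun y => iter_derive (map L vs) g (a + L y)}.
  by apply: filterS nU => y; exact: IH.
rewrite (near_eq_derive v nE).
apply: (@derive_affine R V W X L a (iter_derive (map L vs) g)) => //.
by apply: smooth_at_differentiable; apply: smooth_at_iter_derive; exact: sg.
Qed.

Lemma iter_derive_cst (V W : normedModType R) (vs : seq V) (w : W) x :
  iter_derive vs (cst w) x = if vs is [::] then w else 0.
Proof.
case/lastP: vs => [|vs v] //; rewrite iter_derive_rcons.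
have -> : 'D_v (cst w : V -> W) = cst 0 by apply/funext => y; rewrite derive_cst.
case: (rcons vs v) (size_rcons vs v) => // _ _ _.
elim: vs x => // u vs IH x /=.
have -> : iter_derive vs (cst 0 : V -> W) = cst 0 by apply/funext.
by rewrite derive_cst.
Qed.

(** The divided monomial [x^a / a!], normalized so that its partial derivatives at 0 are Kronecker
    symbols. *)
Definition mono p (a : 'I_p -> nat) (x : 'rV[R]_p) : R :=
  \prod_i (x 0 i ^+ a i / (a i)`!%:R).

Lemma smooth_at_exp (V : normedModType R) (f : V -> R) n x :
  smooth_at f x -> smooth_at (fun y => f y ^+ n) x.
Proof.
move=> sf; elim: n => [|n IH]; first exact: smooth_at_cst.
have -> : (fun y => f y ^+ n.+1) = fun y => f y * f y ^+ n.
  by apply/funext => y; rewrite exprS.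
exact: smooth_atM.
Qed.

Lemma smooth_at_mono p (a : 'I_p -> nat) x : smooth_at (mono a) x.
Proof.
apply: smooth_at_prod => i _; apply: smooth_atM; last exact: smooth_at_cst.
apply: smooth_at_exp; exact: (smooth_at_entry 0 i (smooth_at_id x)).
Qed.

Definition dec_at p (i : 'I_p) (a : 'I_p -> nat) (j : 'I_p) : nat :=
  if j == i then (a j).-1 else a j.

Lemma derive_mono p (a : 'I_p -> nat) (i : 'I_p) :
  'D_(delta_mx 0 i) (mono a) = if a i == 0%N then cst 0 else mono (dec_at i a).
Proof.
apply/funext => x.
pose rest : R := \prod_(j | j != i) (x 0 j ^+ a j / (a j)`!%:R).
pose C : R := (a i)`!%:R^-1 * rest.
(* Along the direction [i] the monomial is a power of one real variable times the constant [C]. *)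
have E t : mono a (t *: delta_mx 0 i + x) = (t + x 0 i) ^+ a i * C.
  rewrite /mono (bigD1 i) //= !mxE !eqxx mulr1 /C mulrA; congr (_ * _).
  by apply: eq_bigr => j ji; rewrite !mxE eqxx (negbTE ji) mulr0 add0r.
have -> : 'D_(delta_mx 0 i) (mono a) x = 'D_1 (fun t : R => t ^+ a i * C) (x 0 i).
  have Ef : (fun h : R => h^-1 *: ((mono a \o shift x) (h *: delta_mx 0 i) - mono a x)) =
      (fun h : R => h^-1 *: (((fun t : R => t ^+ a i * C) \o shift (x 0 i)) (h *: 1)
         - (x 0 i) ^+ a i * C)).
    apply/funext => h /=; rewrite E [h%:A]mulr1; congr (_ *: (_ - _)).
    by have := E 0; rewrite scale0r !add0r.
  by rewrite /derive Ef.
case ai : (a i) => [|q] /=.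
  have -> : (fun t : R => t ^+ 0 * C) = cst C by apply/funext => t; rewrite expr0 mul1r.
  by rewrite derive_cst.
have -> : 'D_1 (fun t : R => t ^+ q.+1 * C) (x 0 i) = C * (q.+1%:R * x 0 i ^+ q).
  rewrite -[fun t : R => _]/((fun t : R => t ^+ q.+1) * cst C) deriveM; last 2 first.
  - exact: exprn_derivable.
  - exact: derivable_cst.
  rewrite derive_cst scaler0 add0r exp_derive /GRing.scale /=.
  by rewrite mulr1.
rewrite /mono (bigD1 i) //= /dec_at eqxx ai /= /C ai.
have -> : \prod_(j < p | j != i) (x 0 j ^+ (if j == i then (a j).-1 else a j) /
     (if j == i then (a j).-1 else a j)`!%:R) = rest.
  by apply: eq_bigr => j /negbTE ->.
rewrite factS natrM invfM; have q0 : q.+1%:R != 0 :> R by rewrite pnatr_eq0.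
have f0 : q`!%:R != 0 :> R by rewrite pnatr_eq0 -lt0n fact_gt0.
by move: q.+1%:R q0 q`!%:R f0 => y y0 z z0; field; rewrite y0 z0.
Qed.

Lemma iter_derive_mono p (s : seq 'I_p) (a : 'I_p -> nat) :
  iter_derive [seq (delta_mx 0 i : 'rV[R]_p) | i <- s] (mono a) 0 =
  [forall i, count_mem i s == a i]%:R.
Proof.
elim/last_ind: s a => [|s i IH] a.
  rewrite /= /mono; case: forallP => [a0|/forallP].
    by rewrite big1 // => i _; rewrite -(eqP (a0 i)) expr0 fact0 divr1.
  rewrite negb_forall => /existsP[i ai].
  by rewrite (bigD1 i) //= mxE expr0n eq_sym (negbTE ai) /= !mul0r.
rewrite map_rcons iter_derive_rcons derive_mono.
have cr j : count_mem j (rcons s i) = (count_mem j s + (i == j))%N.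
  by rewrite -cats1 count_cat /= addn0.
case: eqP => [ai|/eqP ai].
  rewrite iter_derive_cst; have -> : [forall j, count_mem j (rcons s i) == a j] = false.
    by apply/negbTE/forallPn; exists i; rewrite cr eqxx ai addn1.
  by case: map.
rewrite IH; congr (_%:R); congr (nat_of_bool _); apply/eq_forallb => j.
rewrite cr /dec_at [i == j]eq_sym; case: (j =P i) => [->|_] /=; last by rewrite addn0.
by rewrite addn1 -[in RHS](prednK (n := a i)) ?lt0n.
Qed.

Lemma partial_derive_mono p k (J K : multi_index p k) :
  partial_derive J (mono (fun i => val K i)) 0 = (J == K)%:R :> R.
Proof.
rewrite partial_deriveE iter_derive_mono; congr (_%:R); congr (nat_of_bool _).
have cJ i : count_mem i (flatten [seq nseq (val J j) j | j <- enum 'I_p]) = val J i :> nat.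
  rewrite count_flatten -map_comp sumnE big_map big_enum /=.
  rewrite (bigD1 i) //= count_nseq /= eqxx mul1n big1 ?addn0 // => j ji.
  by rewrite count_nseq /= (negbTE ji).
apply/forallP/eqP => [H|JK i]; last by rewrite cJ JK.
by apply/val_inj/ffunP => i; apply/val_inj; rewrite -[LHS]cJ; exact/eqP/H.
Qed.

End Monomials.

(** * Iterated derivatives of sums, and slices of maps on a product *)

Section PairMaps.
Variable R : realType.
Implicit Types V W X : normedModType R.

Lemma iter_deriveD V W (vs : seq V) (f g : V -> W) x :
  smooth_at f x -> smooth_at g x ->
  iter_derive vs (fun y => f y + g y) x = iter_derive vs f x + iter_derive vs g x.
Proof.
elim/last_ind: vs f g => [|vs v IH] f g sf sg //; rewrite !iter_derive_rcons.
rewrite -IH; try exact: smooth_at_derive.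
have nE : {near x, 'D_v (fun y => f y + g y) =1 fun y => 'D_v f y + 'D_v g y}.
  apply: filterS2 (ndiff_diff (sf 0%N)) (ndiff_diff (sg 0%N)) => y fy gy.
  by rewrite -[LHS]/('D_v (f + g) y) deriveD //; exact: diff_derivable.
exact: (nbhs_singleton (near_iter_derive vs nE)).
Qed.

Lemma iter_derive_linear_comp V W X (L : {linear W -> X}) (vs : seq V) (f : V -> W) x :
  continuous L -> smooth_at f x -> iter_derive vs (L \o f) x = L (iter_derive vs f x).
Proof.
move=> cL; elim/last_ind: vs f => [|vs v IH] f sf //; rewrite !iter_derive_rcons.
rewrite -IH; last exact: smooth_at_derive.
have nE : {near x, 'D_v (L \o f) =1 L \o 'D_v f}.
  apply: filterS (ndiff_diff (sf 0%N)) => y fy.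
  exact: (derive_linear_comp v cL fy).
exact: (nbhs_singleton (near_iter_derive vs nE)).
Qed.

Lemma iter_deriveZl V W (vs : seq V) (a : V -> R) (w : W) x : smooth_at a x ->
  iter_derive vs (fun y => a y *: w) x = (iter_derive vs a x : R) *: w.
Proof.
move=> sa.
have sx_lin : linear ( *:%R ^~ w : R^o -> W).
  by move=> u y z; rewrite scalerDl scalerA.
pose sxlM := GRing.isLinear.Build _ _ _ _ _ sx_lin.
pose sxL : {linear R^o -> W} := HB.pack ( *:%R ^~ w) sxlM.
exact: (@iter_derive_linear_comp V R^o W sxL vs a x (@scalel_continuous R W w) sa).
Qed.

Lemma iter_derive_sum V W (I : Type) (s : seq I) (F : I -> V -> W) (vs : seq V) x :
  (forall i, smooth_at (F i) x) ->
  iter_derive vs (fun y => \sum_(i <- s) F i y) x = \sum_(i <- s) iter_derive vs (F i) x.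
Proof.
move=> sF; elim: s => [|i s IH].
  have -> : (fun y => \sum_(i <- [::]) F i y) = cst 0.
    by apply/funext => y; rewrite big_nil.
  by rewrite big_nil iter_derive_cst; case: vs.
have -> : (fun y => \sum_(j <- i :: s) F j y) = fun y => F i y + \sum_(j <- s) F j y.
  by apply/funext => y; rewrite big_cons.
by rewrite iter_deriveD ?IH ?big_cons //; exact: smooth_at_sum.
Qed.

Lemma smooth_at_comp_linear V W X (L : {linear V -> W}) (g : W -> X) x :
  continuous L -> smooth_at g (L x) -> smooth_at (g \o L) x.
Proof.
move=> cL sg; have -> : g \o L = fun y => g (0 + L y).
  by apply/funext => y /=; rewrite add0r.
by apply: smooth_at_affine => //; rewrite add0r.
Qed.

Lemma fst_continuous V W : continuous (fst : V * W -> V).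
Proof. by move=> x; exact: cvg_fst. Qed.

Lemma snd_continuous V W : continuous (snd : V * W -> W).
Proof. by move=> x; exact: cvg_snd. Qed.

(** The pair [(v, w)] is [inlp W v + inrp V w], so that freezing one variable of a map on a product
    is composition with an affine map. *)
Definition inlp V W (v : V) : V * W := (v, 0).
Definition inrp V W (w : W) : V * W := (0, w).

Lemma inlp_is_linear V W : linear (@inlp V W).
Proof.
move=> a u v; have E : a *: 0 + 0 = 0 :> W by rewrite scaler0 addr0.
by rewrite /inlp -[in LHS]E.
Qed.

Lemma inrp_is_linear V W : linear (@inrp V W).
Proof.
move=> a u v; have E : a *: 0 + 0 = 0 :> V by rewrite scaler0 addr0.
by rewrite /inrp -[in LHS]E.
Qed.

HB.instance Definition _ V W := GRing.isLinear.Build R V (V * W)%type _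
  (@inlp V W) (@inlp_is_linear V W).
HB.instance Definition _ V W := GRing.isLinear.Build R W (V * W)%type _
  (@inrp V W) (@inrp_is_linear V W).

Lemma inlp_continuous V W : continuous (@inlp V W).
Proof. by move=> x; apply: cvg_pair; [exact: cvg_id|exact: cvg_cst]. Qed.

Lemma inrp_continuous V W : continuous (@inrp V W).
Proof. by move=> x; apply: cvg_pair; [exact: cvg_cst|exact: cvg_id]. Qed.

Lemma slice_continuous V W (v : V) : continuous (fun w : W => (v, w)).
Proof. by move=> x; apply: cvg_pair; [exact: cvg_cst|exact: cvg_id]. Qed.

Lemma inlrp V W (v : V) (w : W) : inlp W v + inrp V w = (v, w).
Proof.
by rewrite -[LHS]/((v + 0, 0 + w) : V * W) addr0 add0r.
Qed.

End PairMaps.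

Section Deformation.
Variables (R : realType) (p k m : nat).
Notation K := #|multi_index p k|.

(** The Taylor polynomial at 0 with prescribed derivatives [w], indexed as in [velocity]. *)
Definition taylor (w : 'M[R]_(K, m)) (x : 'rV[R]_p) : 'rV[R]_m :=
  \sum_(J < K) mono (fun i => val (enum_val J) i) x *: row J w.

Lemma taylor0 x : taylor 0 x = 0.
Proof. by apply: big1 => J _; rewrite row0 scaler0. Qed.

Lemma smooth_at_taylor w x : smooth_at (taylor w) x.
Proof. by apply: smooth_at_sum => J _; apply: smooth_atZl; exact: smooth_at_mono. Qed.

Lemma smooth_at_taylor2 (w0 : 'M[R]_(K, m)) (u : 'M[R]_(K, m) * 'rV[R]_p) :
  smooth_at (fun u => taylor (u.1 - w0) u.2) u.
Proof.
apply: smooth_at_mx => i a.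
have -> : (fun u : 'M[R]_(K, m) * 'rV[R]_p => taylor (u.1 - w0) u.2 i a) =
  fun u => \sum_(J < K) mono (fun i => val (enum_val J) i) u.2 * (u.1 J a + - w0 J a).
  apply/funext => v; rewrite /taylor summxE; apply: eq_bigr => J _.
  by rewrite !mxE.
apply: smooth_at_sum => J _; apply: smooth_atM.
  apply: (@smooth_at_comp_linear R _ _ _ snd (mono (fun i => val (enum_val J) i))).
    exact: snd_continuous.
  exact: smooth_at_mono.
apply: smooth_atD; last exact: smooth_at_cst.
apply: (@smooth_at_comp_linear R _ _ R^o fst (mxentry J a)).
  exact: fst_continuous.
exact: (smooth_at_entry J a (smooth_at_id _)).
Qed.

Lemma partial_derive_taylor (w : 'M[R]_(K, m)) (J : multi_index p k) :
  partial_derive J (taylor w) 0 = row (enum_rank J) w.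
Proof.
rewrite /partial_derive iter_derive_sum; last first.
  by move=> L; apply: smooth_atZl; exact: smooth_at_mono.
rewrite (bigD1 (enum_rank J)) //= iter_deriveZl; last exact: smooth_at_mono.
rewrite -[iter_derive _ _ _]/(partial_derive J _ 0) partial_derive_mono enum_rankK.
rewrite eqxx scale1r big1 ?addr0 // => L LJ.
rewrite iter_deriveZl; last exact: smooth_at_mono.
rewrite -[iter_derive _ _ _]/(partial_derive J _ 0) partial_derive_mono.
case: eqP => [E|]; last by rewrite scale0r.
by rewrite E enum_valK eqxx in LJ.
Qed.

Variables (n : nat) (M N : topologicalType).
Variables (AM : manifold R m M) (AN : manifold R n N) (F : M -> N).
Hypothesis sF : smooth_map AM AN F.

(** The submanifold that realizes [w] need not be regular; it is only in contact with a regular one,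
    to which [contact_lift] moves the velocity. *)
Lemma regular_jet_param (c : chart R m M) (w : 'M[R]_(K, m)) j : atlas AM c ->
  regular_jets AM AN p k F j -> jet_velocity AM c w j ->
  exists z S s, [/\ cdom c z, regular AM AN p F S, local_param AM S z s,
    w = velocity k c s & j = jet AM p k z S].
Proof.
move=> ac [z [S [sS rS Sz ->]]] [z' [S' [s' [cz' sS' ls' -> E]]]].
have [zz C] := jet_eq sS' (local_param_mem ls') E.
rewrite -zz in ls' cz'.
have [s ls Es] := contact_lift (contact_sym C) ls'.
by exists z, S, s; split=> //; rewrite Es.
Qed.

(* A nearby velocity [w] is realized by adding to [c o s] the polynomial with
   velocity [w - w0] at 0; [c o s] itself is kept so that the deformation is
   still an immersion when [k = 0].  In coordinates the jet projection is then a
   derivative of a jointly smooth function of [w] and the parameter. *)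
Lemma jet_chart_lift (c : chart R m M) (w0 : 'M[R]_(K, m)) j0 : atlas AM c ->
  regular_jets AM AN p k F j0 -> jet_velocity AM c w0 j0 ->
  exists (c' : chart R n N) (Phi : 'M[R]_(K, m) -> 'M[R]_(K, n)),
    [/\ atlas AN c', smooth_at Phi w0 &
      \forall w \near w0, exists j, [/\ regular_jets AM AN p k F j,
        jet_velocity AM c w j &
        jet_velocity AN c' (Phi w) (jet_projection AM AN p k F j)]].
Proof.
move=> ac rj vj; have [z [S [s [cz rS ls w0E _]]]] := regular_jet_param ac rj vj.
have s0 := local_param0 ls; have [c' ac' c'z] := atlas_cover AN (F z).
have ss := local_param_smooth ls; have ss0 := nbhs_singleton ss.
have cz0 : cdom c (s 0) by rewrite s0.
set phi := c \o s; have sphi := near_smooth_on_chart ss ac cz0.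
have sphi0 : smooth_at phi 0 := nbhs_singleton sphi.
pose psi (u : 'M[R]_(K, m) * 'rV[R]_p) := phi u.2 + taylor (u.1 - w0) u.2.
pose H u := (c' \o F \o cinv c) (psi u).
have psi0 x : psi (w0, x) = phi x by rewrite /psi /= subrr taylor0 addr0.
have spsi u : smooth_at phi u.2 -> smooth_at psi u.
  move=> su; apply: smooth_atD; last exact: smooth_at_taylor2.
  by apply: (@smooth_at_comp_linear R _ _ _ snd phi); [exact: snd_continuous|].
have cpsi : {for (w0, 0), continuous psi} by apply: smooth_at_continuous; exact: spsi.
have cim0 : cimg c (psi (w0, 0)) by rewrite psi0; exact: cimg_map.
have c'0 : cdom c' (F (cinv c (psi (w0, 0)))) by rewrite psi0 /phi /= cmapK // s0.
have nA : nbhs (w0, 0 : 'rV[R]_p) [set u | [/\ smooth_at phi u.2, cimg c (psi u) &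
    cdom c' (F (cinv c (psi u)))]].
  have n1 : \forall u \near (w0, 0 : 'rV[R]_p), smooth_at phi u.2.
    exact: (@snd_continuous R _ _ (w0, 0) _ sphi).
  have n2 : \forall u \near (w0, 0 : 'rV[R]_p), cimg c (psi u).
    exact: (cpsi _ (near_cimg cim0)).
  have n3 : \forall u \near (w0, 0 : 'rV[R]_p), cdom c' (F (cinv c (psi u))).
    have cc : {for psi (w0, 0), continuous (F \o cinv c)}.
      exact: (smoothM_chartmap sF ac cim0).1.
    exact: (cpsi _ (near_continuous_cdom cc c'0)).
  by apply: filterS3 n1 n2 n3 => u; exact: And3.
move: nA; rewrite nbhsE => -[U [oU U0] UA].
have sH u : U u -> smooth_at H u.
  move=> /UA[su cu c'u]; apply: smooth_at_comp; first exact: spsi.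
  have := smooth_map_at sF ac (cinv_dom cu) ac' c'u.
  by rewrite cinvK.
have nU w : U (w, 0) -> \forall x \near (0 : 'rV[R]_p), U (w, x).
  by move=> Uw; exact: (@slice_continuous R _ _ w 0 _ (open_nbhs_nbhs (conj oU Uw))).
pose sg w x := cinv c (psi (w, x)).
have HE w : (fun x : 'rV[R]_p => H (w, x)) = fun x => H (inlp _ w + inrp _ x).
  by apply/funext => x; rewrite inlrp.
have iH w (vs : seq 'rV[R]_p) : U (w, 0) ->
    iter_derive vs (fun x => H (w, x)) 0 = iter_derive (map (@inrp R _ _) vs) H (w, 0).
  move=> Uw; rewrite HE.
  have Uw0 : U (inlp _ w + inrp _ 0) by rewrite inlrp.
  have := @iter_derive_affine R _ _ _ (@inrp R 'M[R]_(K, m) 'rV[R]_p) (inlp _ w) H U vs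
    (@inrp_continuous R _ _) oU sH 0 Uw0.
  by rewrite inlrp.
(* The velocity of [F \o sg w] in [c'], written with derivatives of [H] along the second factor so
   that its smooth dependence on [w] is visible. *)
pose Phi w : 'M[R]_(K, n) := \matrix_(J < K, b < n) iter_derive (map (@inrp R 'M[R]_(K, m) _)
    (flatten [seq nseq (val (enum_val J) i) (delta_mx 0 i) | i <- enum 'I_p])) H
    (w, 0) 0 b.
have sslice (G : 'M[R]_(K, m) * 'rV[R]_p -> 'rV[R]_n) : smooth_at G (w0, 0) ->
    smooth_at (fun w => G (w, 0)) w0.
  move=> sG; apply: (@smooth_at_comp_linear R _ _ _ (@inlp R _ _) G).
    exact: inlp_continuous.
  exact: sG.
have sPhi : smooth_at Phi w0.
  apply: smooth_at_mx => J b.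
  have -> : (fun w => Phi w J b) = fun w => iter_derive (map (@inrp R 'M[R]_(K, m) _)
    (flatten [seq nseq (val (enum_val J) i) (delta_mx 0 i) | i <- enum 'I_p])) H
    (w, 0) 0 b by apply/funext => w; rewrite mxE.
  apply: smooth_at_entry; apply: sslice.
  by apply: smooth_at_iter_derive; exact: sH.
pose Jm w : 'M[R]_(p, n) := \matrix_(i, b) 'D_(inrp _ (delta_mx 0 i)) H (w, 0) 0 b.
have sJm : smooth_at Jm w0.
  apply: smooth_at_mx => i b.
  have -> : (fun w => Jm w i b) = fun w => 'D_(inrp _ (delta_mx 0 i)) H (w, 0) 0 b.
    by apply/funext => w; rewrite mxE.
  apply: smooth_at_entry; apply: (sslice ('D_(inrp _ (delta_mx 0 i)) H)).
  by apply: smooth_at_derive; exact: sH.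
have JmE w : U (w, 0) -> derive_mxf (fun x => H (w, x)) 0 = Jm w.
  move=> Uw; apply/matrixP => i b; rewrite !mxE.
  by have /= -> := iH w [:: delta_mx 0 i] Uw.
have dH w : U (w, 0) -> differentiable (fun x => H (w, x)) 0.
  move=> Uw; rewrite HE; apply: smooth_at_differentiable.
  apply: (smooth_at_affine (@inrp_continuous R _ _)); rewrite inlrp.
  exact: sH.
have free0 : row_free (Jm w0).
  apply: inj_row_free => v; rewrite -JmE // -derive_mxfE; last exact: dH.
  rewrite deriveE; last exact: dH.
  have c's0 : cdom c' (F (s 0)) by rewrite s0.
  have injs := regular_immersive sF rS ls ac' c's0.
  have nE : {near (0 : 'rV[R]_p), (fun x => H (w0, x)) =1 c' \o (F \o s)}.
    apply: filterS (near_continuous_cdom ss0.1 cz0) => x cx.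
    by rewrite /H psi0 /phi /= cmapK.
  move=> v0; apply: injs; rewrite linear0.
  by rewrite -[LHS](near_diff v nE (dH w0 U0)).
(* Injectivity of the differential persists for nearby [w]: the square matrix [Jm w *m B] is 1 at
   [w0] and its determinant is continuous in [w]. *)
set B := pinvmx (Jm w0).
have ndet : \forall w \near w0, \det (Jm w *m B) != 0.
  have sd : smooth_at (fun w => \det (Jm w *m B) : R) w0.
    apply: smooth_at_det => i j; apply: smooth_at_entry; apply: smooth_at_mulmx => //.
    exact: smooth_at_cst.
  have d0 : nbhs (\det (Jm w0 *m B)) [set t : R | t != 0].
    apply: open_nbhs_nbhs; split; first exact: open_neq.
    by rewrite /= mulmxVp // det1 oner_neq0.
  exact: (smooth_at_continuous sd d0).
have nUw : \forall w \near w0, U (w, 0).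
  exact: (@inlp_continuous R _ _ w0 _ (open_nbhs_nbhs (conj oU U0))).
exists c', Phi; split=> //.
apply: filterS2 ndet nUw => w dw Uw.
have sgS : \forall x \near (0 : 'rV[R]_p), smoothM AM (sg w) x.
  apply: filterS (nU w Uw) => x Uwx; have [sx cx c'x] := UA _ Uwx.
  apply: (smoothM_comp (f := fun x => psi (w, x))).
    by apply: smooth_atD; [exact: sx|exact: (smooth_at_taylor (w - w0) x)].
  exact: smoothM_cinv.
have [_ cw c'w] := UA _ Uw.
have csg : cdom c (sg w 0) by exact: cinv_dom.
have injw : injective ('d (c' \o F \o sg w) 0).
  apply/injective_diffP => v.
  have -> : c' \o F \o sg w = fun x => H (w, x) by [].
  rewrite -(deriveE v (dH w Uw)) (derive_mxfE v (dH w Uw)) (JmE w Uw) => v0.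
  have uJ : Jm w *m B \in unitmx by rewrite unitmxE unitfE.
  by rewrite -[v](mulmxK uJ) mulmxA v0 !mul0mx.
(* Restricted to a small ball of parameters, [sg w] sweeps out a regular submanifold embedded by
   [F], on which [jet_projectionE] computes the projection. *)
have [B0 nB0 HB0] := regular_patch sF sgS ac' c'w injw.
move: nB0; rewrite nbhsE => -[B1 [oB1 B10] B1B0].
have [sB rB eB lB] := HB0 B1 oB1 B1B0 B10.
set T := sg w @` B1 in sB rB eB lB.
have Tz := local_param_mem lB.
exists (jet AM p k (sg w 0) T); split.
- by exists (sg w 0), T.
- exists (sg w 0), T, (sg w); split=> //.
  apply/matrixP => J a; rewrite mxE.
  have nE : {near (0 : 'rV[R]_p), c \o sg w =1 fun x => phi x + taylor (w - w0) x}.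
    apply: filterS (nU w Uw) => x Uwx; have [_ cx _] := UA _ Uwx.
    by rewrite /= /sg cinvK.
  rewrite /partial_derive (nbhs_singleton (near_iter_derive _ nE)).
  rewrite (iter_deriveD _ sphi0 (smooth_at_taylor (w - w0) 0)).
  have := congr1 (fun v : 'rV[R]_m => v 0 a)
    (partial_derive_taylor (w - w0) (enum_val J)).
  rewrite enum_valK /partial_derive !mxE => ->.
  by rewrite {1}w0E mxE /partial_derive addrC subrK.
- rewrite jet_projectionE //; exists (F (sg w 0)), (F @` T), (F \o sg w); split=> //.
  + exact: (submanifold_image sF sB rB eB).
  + exact: (local_param_image sF rB eB lB).
  + apply/matrixP => J b; rewrite !mxE /partial_derive.
    have -> : c' \o (F \o sg w) = fun x => H (w, x) by [].
    by rewrite iH.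
Qed.

End Deformation.

(** * Invariance *)

Section GenericMatrix.

(** A nonzero [q] has fewer than [size q] roots, so one of the first [size q] naturals is not a
    root. *)
Lemma polynomial_nonroot (R : realFieldType) (q : {poly R}) :
  q != 0 -> exists t, q.[t] != 0.
Proof.
move=> q0; pose rs := [seq i%:R : R | i <- iota 0 (size q)].
have urs : uniq rs.
  rewrite map_inj_in_uniq ?iota_uniq // => i j _ _ /eqP.
  by rewrite eqr_nat => /eqP.
have : ~~ all (root q) rs.
  apply/negP => Hr; have := max_poly_roots q0 Hr urs.
  by rewrite size_map size_iota ltnn.
by case/allPn => t _ rt; exists t.
Qed.

Lemma det_segment_poly (R : realFieldType) p (X Y : 'M[R]_p) :
  exists q : {poly R}, forall t, q.[t] = \det (X + t *: (Y - X)).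
Proof.
exists (\det (map_mx polyC X + 'X *: map_mx polyC (Y - X))) => t.
rewrite -[LHS]/(horner_eval t _) -det_map_mx; congr (\det _).
by apply/matrixP => i j; rewrite !mxE /= /horner_eval !hornerE.
Qed.

(** Move along the segment from [A1] to [A2]. The determinants of [A *m J1 *m B1] and
    [A *m J2 *m B2] are polynomials in [t], equal to 1 at [t = 0] and at [t = 1] respectively; any
    [t] where their product does not vanish gives a suitable [A]. *)
Lemma common_row_free (R : realFieldType) p m n (A1 A2 : 'M[R]_(p, m)) (J1 J2 : 'M[R]_(m, n)) :
  row_free (A1 *m J1) -> row_free (A2 *m J2) ->
  exists A : 'M[R]_(p, m), row_free (A *m J1) /\ row_free (A *m J2).
Proof.
move=> f1 f2; set B1 := pinvmx (A1 *m J1); set B2 := pinvmx (A2 *m J2).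
pose X i := if i then A1 *m J1 *m B1 else A1 *m J2 *m B2.
pose Y i := if i then A2 *m J1 *m B1 else A2 *m J2 *m B2.
have [q1 E1] := det_segment_poly (X true) (Y true).
have [q2 E2] := det_segment_poly (X false) (Y false).
have q10 : q1 != 0.
  apply: contra_eq_neq (E1 0) => ->; rewrite horner0 scale0r addr0 /X mulmxVp // det1.
  by rewrite eq_sym oner_neq0.
have q20 : q2 != 0.
  apply: contra_eq_neq (E2 1) => ->.
  by rewrite horner0 scale1r addrC subrK /Y mulmxVp // det1 eq_sym oner_neq0.
have [t] := polynomial_nonroot (mulf_neq0 q10 q20).
rewrite hornerM mulf_eq0 negb_or E1 E2 => /andP[d1 d2].
exists (A1 + t *: (A2 - A1)).
have H (J : 'M[R]_(m, n)) B : \det (A1 *m J *m B + t *: (A2 *m J *m B - A1 *m J *m B)) != 0 ->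
    row_free ((A1 + t *: (A2 - A1)) *m J).
  move=> d0; apply: inj_row_free => v v0.
  have uA : (A1 + t *: (A2 - A1)) *m J *m B \in unitmx.
    rewrite unitmxE unitfE; apply: contraNN d0 => /eqP <-; apply/eqP; congr (\det _).
    by rewrite [in RHS]mulmxDl -[in RHS]scalemxAl mulmxBl [in RHS]mulmxDl -[in RHS]scalemxAl mulmxBl.
  by rewrite -[v](mulmxK uA) !mulmxA -[v *m _ *m J]mulmxA v0 !mul0mx.
by split; [exact: H d1|exact: H d2].
Qed.

End GenericMatrix.

(** * Domain and smoothness of the pulled back function *)

Section Main.
Variables (R : realType) (p k m n : nat) (M N : topologicalType).
Variables (AM : manifold R m M) (AN : manifold R n N) (F : M -> N).
Hypothesis sF : smooth_map AM AN F.

(** A single [f] is wanted on all coordinates of [c], while [jet_chart_lift] is local and its target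
    chart [c'] varies. So [f] is defined by choosing a jet for each velocity, and near each [w0] it
    is recognized as [fN \o Phi]. *)
Lemma pullback_differential_function (domI : set (jet_of N)) (I : jet_of N -> R) :
  differential_function AN p k domI I ->
  differential_function AM p k
    (regular_jets AM AN p k F `&` jet_projection AM AN p k F @^-1` domI)
    (I \o jet_projection AM AN p k F).
Proof.
move=> [[sub oI] dI]; set D := _ `&` _.
have local_lift c w0 : atlas AM c -> jet_coords AM (p := p) (k := k) c D w0 ->
    exists (c' : chart R n N) (Phi : _ -> 'M[R]_(#|multi_index p k|, n)),
    [/\ atlas AN c', smooth_at Phi w0, jet_coords AN (p := p) (k := k) c' domI (Phi w0) &
    \forall w \near w0, exists j, [/\ D j, jet_velocity AM (p := p) (k := k) c w j &
      jet_velocity AN (p := p) (k := k) c' (Phi w) (jet_projection AM AN p k F j)]].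
  move=> ac [j0 [rj0 dj0] vj0].
  have [c' [Phi [ac' sPhi nj]]] := jet_chart_lift sF ac rj0 vj0.
  have Phi0 : jet_coords AN (p := p) (k := k) c' domI (Phi w0).
    have [j [_ vj vPj]] := nbhs_singleton nj.
    have jj0 := jet_velocity_uniq ac vj vj0.
    by exists (jet_projection AM AN p k F j); rewrite ?jj0 // jj0 in vPj *.
  exists c', Phi; split=> //.
  (* The coordinates of [domI] in [c'] are open, so [Phi w] stays among them; as a velocity
     determines its jet, the projected jet itself lies in [domI]. *)
  have nPhi : \forall w \near w0, jet_coords AN (p := p) (k := k) c' domI (Phi w).
    exact: (smooth_at_continuous sPhi (open_nbhs_nbhs (conj (oI c' ac') Phi0))).
  apply: filterS2 nj nPhi => w [j [rj vj vPj]] [j' dj' vj'].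
  exists j; split=> //; split=> //=.
  by rewrite (jet_velocity_uniq ac' vPj vj').
split.
  split=> [j [[z [S [sS rS Sz ->]]] _]|c ac]; first by exists z, S.
  rewrite openE => w0 cw0; have [c' [Phi [_ _ _ nj]]] := local_lift c w0 ac cw0.
  by apply: filterS nj => w [j [Dj vj _]]; exists j.
move=> c ac.
pose f w := I (jet_projection AM AN p k F
  (xget set0 [set j | D j /\ jet_velocity AM (p := p) (k := k) c w j])).
have fE w j : D j -> jet_velocity AM (p := p) (k := k) c w j -> f w = I (jet_projection AM AN p k F j).
  move=> Dj vj; rewrite /f.
  have [_ vx] := xgetPex set0 (ex_intro (fun j => D j /\ jet_velocity AM (p := p) (k := k) c w j) j (conj Dj vj)).
  by rewrite (jet_velocity_uniq ac vx vj).
exists f => //.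
have oD : open (jet_coords AM (p := p) (k := k) c D).
  rewrite openE => w0 cw0; have [c' [Phi [_ _ _ nj]]] := local_lift c w0 ac cw0.
  by apply: filterS nj => w [j [Dj vj _]]; exists j.
apply/smooth_onP => // w0 cw0.
have [c' [Phi [ac' sPhi cPhi nj]]] := local_lift c w0 ac cw0.
have [fN sfN fNE] := dI c' ac'.
have sfN0 : smooth_at fN (Phi w0).
  by move: sfN; rewrite smooth_onP; [apply|exact: oI].
apply: (@smooth_at_near R _ _ (fN \o Phi)); last exact: smooth_at_comp_real.
apply: filterS nj => w [j [Dj vj vPj]] /=.
by rewrite (fE w j Dj vj) (fNE _ _ Dj.2 vPj).
Qed.

End Main.

(** * The action on [M] and the action it induces on [N] *)

Section GroupAction.
Variables (R : realType) (d p k m n : nat) (M N : topologicalType).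
Variables (AM : manifold R m M) (AN : manifold R n N) (F : M -> N).
Variables (G : topGroupType) (LG : lie_group R d G) (act : G -> M -> M).
Hypothesis sF : smooth_map AM AN F.
Hypothesis F_onto : forall v : N, exists z : M, F z = v.
Hypothesis act_lie : lie_action LG AM act.
Hypothesis act_proj : projectable F act.

Lemma actK g z : act g^-1%g (act g z) = z.
Proof. by rewrite -(lie_actM act_lie) mulVg (lie_act1 act_lie). Qed.

Lemma actVK g z : act g (act g^-1%g z) = z.
Proof. by rewrite -(lie_actM act_lie) mulgV (lie_act1 act_lie). Qed.

Lemma smooth_act g : smooth_map AM AM (act g).
Proof.
move=> c ac; rewrite smooth_intoP; last exact: cimg_open.
move=> x cx; have [a aa ag] := atlas_cover LG g.
have oX : open (cimg a `*` cimg c).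
  rewrite openE => -[u v] [au cv]; exists (cimg a, cimg c) => //=.
  by split; apply: open_nbhs_nbhs; split=> //; exact: cimg_open.
have := lie_act_smooth act_lie aa ac; rewrite smooth_intoP //.
move=> /(_ (a g, x) (conj (cimg_map ag) cx)).
rewrite -inlrp => sx.
pose f (u : 'rV[R]_d * 'rV[R]_m) := act (cinv a u.1) (cinv c u.2).
have -> : act g \o cinv c = fun y => f (inlp _ (a g) + inrp _ y).
  by apply/funext => y; rewrite inlrp /f /= cmapK.
exact: (smoothM_affine (@inrp_continuous R _ _) sx).
Qed.

Lemma embeds_act g (A : set M) : embeds (act g) A.
Proof.
apply: (@embeds_postcomp _ _ _ (act g) (act g^-1%g) A setT openT) => // [y _|].
  exact: (smooth_map_continuous (@smooth_act g^-1%g)).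
have -> : act g^-1%g \o act g = id by apply/funext => z; exact: actK.
split=> // D oD; exists D => //; rewrite !image_id //.
Qed.

Lemma immersive_act g (s : 'rV[R]_p -> M) x :
  smoothM AM s x -> immersive AM s x -> immersive AM (act g \o s) x.
Proof.
move=> ss is_; have [c ac cx] := atlas_cover AM (s x).
have sgs := smoothM_map (@smooth_act g) ss.
apply: (immersive_map (@smooth_act g^-1%g) sgs ac); first by rewrite /= actK.
have -> : c \o act g^-1%g \o (act g \o s) = c \o s.
  by apply/funext => y /=; rewrite actK.
exact: is_.
Qed.

(** [act g] is handled as a projection from [M] to [M] whose differential has trivial kernel, so
    that [local_param_image] applies to it. *)
Lemma regular_act g (S : set M) : submanifold AM p S -> regular AM AM p (act g) S.
Proof.
move=> sS; apply: (regular_of_params (@smooth_act g)) => z Sz.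
have [s ls] := sS z Sz; exists s => //; apply: immersive_act.
  exact: (nbhs_singleton (local_param_smooth ls)).
have /local_paramP[_ [U [D [[_ U0 _ _] [_ _ iU]]]]] := ls.
exact: iU.
Qed.

Lemma local_param_act g (S : set M) z (s : 'rV[R]_p -> M) : submanifold AM p S ->
  local_param AM S z s -> local_param AM (act g @` S) (act g z) (act g \o s).
Proof.
move=> sS ls.
exact: (local_param_image (@smooth_act g) (@regular_act g S sS) (@embeds_act g S) ls).
Qed.

(** Whichever [w] is selected by [xget], the point [act g z] lies in the fiber over it, which
    determines [w]. *)
Lemma induced_actE g z : induced_act F act g (F z) = F (act g z).
Proof.
have [w Ew] := act_proj (F z) g.
have := xgetPex (F z) (ex_intro [set w | act g @` fiber F (F z) = fiber F w] w Ew).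
rewrite -/(induced_act F act g (F z)) /= => E.
have : (act g @` fiber F (F z)) (act g z) by exists z.
by rewrite E.
Qed.

Definition isotropy_coset (g : G) : set G :=
  [set (g * h)%g | h in global_isotropy F act].

(** The selected value comes from some [g * h] in the coset, and the isotropy element [h] does not
    move [F z]. *)
Lemma effective_actE g z :
  effective_act F act (isotropy_coset g) (F z) = F (act g z).
Proof.
have gg : isotropy_coset g g.
  exists 1%g; last by rewrite mulg1.
  by move=> v; have [z' <-] := F_onto v; rewrite induced_actE (lie_act1 act_lie).
have [_ [h hN <-] ->] : [set w | exists2 g', isotropy_coset g g' &
    w = induced_act F act g' (F z)] (effective_act F act (isotropy_coset g) (F z)).
  by apply: xgetPex; exists (F (act g z)); exists g; rewrite ?induced_actE.
rewrite induced_actE (lie_actM act_lie) -induced_actE -[F (act h z)]induced_actE hN.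
by rewrite induced_actE.
Qed.

Lemma effective_act_image g (S : set M) :
  effective_act F act (isotropy_coset g) @` (F @` S) = F @` (act g @` S).
Proof.
rewrite eqEsubset; split=> v.
  by case=> _ [z Sz <-] <-; rewrite effective_actE; exists (act g z) => //; exists z.
by case=> _ [z Sz <-] <-; exists (F z); [exists z|rewrite effective_actE].
Qed.

End GroupAction.

Section JetRepresentatives.
Variables (R : realType) (p m n : nat) (M N : topologicalType).
Variables (AM : manifold R m M) (AN : manifold R n N) (F : M -> N).
Hypothesis sF : smooth_map AM AN F.

(** At order 0 the velocity is reduced to the base point. *)
Lemma contact_order0 (S T : set M) z (s t : 'rV[R]_p -> M) :
  local_param AM S z s -> local_param AM T z t -> contact AM p 0 z S T.
Proof.
move=> ls lt; have [c ac cz] := atlas_cover AM z.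
have [s0 t0] := (local_param0 ls, local_param0 lt).
apply: (contact_of_velocity ls lt ac cz).
apply/(velocityP _ (local_param_smooth ls) (local_param_smooth lt) ac);
  rewrite ?s0 ?t0 //.
by split=> //=; rewrite s0 t0.
Qed.

Lemma velocity_diff k (c : chart R n N) (f g : 'rV[R]_p -> N) :
  (\forall x \near (0 : 'rV[R]_p), smoothM AN f x) ->
  (\forall x \near (0 : 'rV[R]_p), smoothM AN g x) ->
  atlas AN c -> cdom c (f 0) -> cdom c (g 0) ->
  velocity k.+1 c f = velocity k.+1 c g ->
  forall v, 'd (c \o f) 0 v = 'd (c \o g) 0 v.
Proof.
move=> sf sg ac cf cg /(velocityP _ sf sg ac cf cg) [_ H] v.
have df := smooth_at_differentiable (nbhs_singleton (near_smooth_on_chart sf ac cf)).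
have dg := smooth_at_differentiable (nbhs_singleton (near_smooth_on_chart sg ac cg)).
rewrite -[LHS](deriveE v df) -[RHS](deriveE v dg).
rewrite [LHS](derive_mxfE v df) [RHS](derive_mxfE v dg).
by congr (_ *m _); apply/matrixP => i j; rewrite !mxE (agree0 (H i)).
Qed.

(** From order 1 on, the jet determines the differential of a parametrization up to a change of
    parameter, so transversality passes from the regular representative [S1] to any parametrization
    of [S]; hence [k.+1]. *)
Lemma regular_jet_immersive k (S : set M) z (s : 'rV[R]_p -> M) :
  regular_jets AM AN p k.+1 F (jet AM p k.+1 z S) -> local_param AM S z s ->
  forall c', atlas AN c' -> cdom c' (F z) -> injective ('d (c' \o F \o s) 0).
Proof.
move=> [z1 [S1 [sS1 rS1 S1z E]]] ls c' ac' c'z.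
have [zz C] := jet_eq sS1 S1z E.
have [t lt Et] := contact_lift C ls.
have [c ac cz] := atlas_cover AM z.
have [s0 t0] := (local_param0 ls, local_param0 lt).
have ss := local_param_smooth ls; have st := local_param_smooth lt.
have [cs0 ct0] : cdom c (s 0) /\ cdom c (t 0) by rewrite s0 t0.
have [c's0 c't0] : cdom c' (F (s 0)) /\ cdom c' (F (t 0)) by rewrite s0 t0.
have sFs : \forall x \near (0 : 'rV[R]_p), smoothM AN (F \o s) x.
  by apply: filterS ss => x; exact: (smoothM_map sF).
have sFt : \forall x \near (0 : 'rV[R]_p), smoothM AN (F \o t) x.
  by apply: filterS st => x; exact: (smoothM_map sF).
have vE := velocity_map sF ss st ac cs0 ct0 ac' c's0 (Et c ac cz).
have dE := velocity_diff sFs sFt ac' c's0 c't0 vE.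
have it := regular_immersive sF rS1 lt ac' c't0.
move=> v w vw; apply: it; rewrite -[LHS]dE -[RHS]dE; exact: vw.
Qed.

End JetRepresentatives.

(** * Compatibility of the projection with the prolonged actions *)

Section Prolongation.
Variables (R : realType) (d p k m n : nat) (M N : topologicalType).
Variables (AM : manifold R m M) (AN : manifold R n N).

Lemma smooth_map_comp (F : M -> N) (f : M -> M) :
  smooth_map AM AN F -> smooth_map AM AM f -> smooth_map AM AN (F \o f).
Proof.
move=> sF sf c ac; rewrite smooth_intoP; last exact: cimg_open.
by move=> x cx; exact: (smoothM_map sF (smoothM_chartmap sf ac cx)).
Qed.

Lemma chart_jacobian_free (H : M -> N) (t : 'rV[R]_p -> M) z c c' :
  smooth_map AM AN H -> smoothM AM t 0 -> t 0 = z -> atlas AM c -> cdom c z ->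
  atlas AN c' -> cdom c' (H z) -> injective ('d (c' \o H \o t) 0) ->
  row_free (derive_mxf (c \o t) 0 *m derive_mxf (c' \o H \o cinv c) (c z)).
Proof.
move=> sH st t0 ac cz ac' c'z inj; rewrite -t0 in cz c'z *.
have dct := smooth_at_differentiable (st.2 c ac cz).
have dH := smooth_at_differentiable (smooth_map_at sH ac cz ac' c'z).
apply: inj_row_free => v; rewrite mulmxA -(derive_mxfE v dct) -(derive_mxfE _ dH).
rewrite (deriveE v dct) (deriveE _ dH) -(diff_chart_factor sH v st ac cz ac' c'z) => v0.
by apply: inj; rewrite v0 linear0.
Qed.

(** Here [A] is the Jacobian at 0 of a plane drawn in the chart [c]; for such a plane the rank
    condition of [chart_jacobian_free] is also sufficient. *)
Lemma affine_chart_injective (H : M -> N) (A : 'M[R]_(p, m)) z c c' :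
  smooth_map AM AN H -> atlas AM c -> cdom c z -> atlas AN c' -> cdom c' (H z) ->
  row_free (A *m derive_mxf (c' \o H \o cinv c) (c z)) ->
  injective ('d (c' \o H \o (fun x : 'rV[R]_p => cinv c (c z + x *m A))) 0).
Proof.
move=> sH ac cz ac' c'z fA; set f := c' \o H \o cinv c.
have cL : continuous (mulmxr A : 'rV[R]_p -> 'rV[R]_m).
  exact: (linear_mx_continuous (L := mulmxr A)).
have sf : smooth_at f (c z + mulmxr A 0).
  by rewrite linear0 addr0; exact: (smooth_map_at sH ac cz ac' c'z).
have dA := smooth_at_differentiable (smooth_at_affine cL sf).
have df := smooth_at_differentiable sf.
apply/injective_diffP => v v0.
have : v *m (A *m derive_mxf f (c z)) = 0.
  rewrite -[RHS]v0 mulmxA; have := derive_affine v cL df.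
  rewrite (derive_mxfE _ df) linear0 addr0 => <-.
  exact: (deriveE v dA).
by rewrite -[0](mul0mx _ (A *m derive_mxf f (c z))) => /(row_free_inj fA).
Qed.

Variables (F : M -> N) (G : topGroupType) (LG : lie_group R d G) (act : G -> M -> M).
Hypothesis sF : smooth_map AM AN F.
Hypothesis F_onto : forall v : N, exists z : M, F z = v.
Hypothesis act_lie : lie_action LG AM act.
Hypothesis act_proj : projectable F act.

(* The case [k = 0] is not covered by the given submanifold [S], which need not
   be transverse to the fibers at [z]: a generic plane through [z] is. *)
Lemma transverse_param g z (S : set M) :
  submanifold AM p S -> S z -> submanifold AM p (act g @` S) ->
  regular_jets AM AN p k F (jet AM p k z S) ->
  regular_jets AM AN p k F (jet AM p k (act g z) (act g @` S)) ->
  exists s : 'rV[R]_p -> M,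
    [/\ \forall x \near (0 : 'rV[R]_p), smoothM AM s x, s 0 = z,
        (exists c', [/\ atlas AN c', cdom c' (F z) & injective ('d (c' \o F \o s) 0)]) /\
        (exists c', [/\ atlas AN c', cdom c' (F (act g z)) &
                     injective ('d (c' \o F \o (act g \o s)) 0)]),
        forall T, local_param AM T z s -> contact AM p k z S T &
        forall T, local_param AM T (act g z) (act g \o s) ->
          contact AM p k (act g z) (act g @` S) T].
Proof.
move=> sS Sz sgS rj rj'.
have [c1 ac1 c1z] := atlas_cover AN (F z).
have [c2 ac2 c2z] := atlas_cover AN (F (act g z)).
have gSz : (act g @` S) (act g z) by exists z.
have [s0 ls0] := sS z Sz.
have lgs0 := local_param_act act_lie g sS ls0.
case: k rj rj' => [|k'] rj rj'; last first.
  (* In positive order the parametrization of [S] itself is transverse. *)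
  exists s0; split.
  - exact: local_param_smooth ls0.
  - exact: local_param0 ls0.
  - split; first by exists c1; split=> //; exact: (regular_jet_immersive sF rj ls0).
    by exists c2; split=> //; exact: (regular_jet_immersive sF rj' lgs0).
  - by move=> T lT; exists s0, s0.
  - by move=> T lT; exists (act g \o s0), (act g \o s0).
have [c ac cz] := atlas_cover AM z.
have sg : smooth_map AM AM (act g) := @smooth_act _ _ _ _ _ _ _ _ act_lie g.
have sg' : smooth_map AM AM (act g^-1%g) := @smooth_act _ _ _ _ _ _ _ _ act_lie g^-1%g.
have sFg := smooth_map_comp sF sg.
have [z1 [S1 [sS1 rS1 S1z1 E1]]] := rj; have [zz1 _] := jet_eq sS1 S1z1 E1.
rewrite -zz1 in S1z1; have [t1 lt1] := sS1 z S1z1.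
have t10 := local_param0 lt1; have st1 := nbhs_singleton (local_param_smooth lt1).
have c1t1 : cdom c1 (F (t1 0)) by rewrite t10.
have f1 := chart_jacobian_free sF st1 t10 ac cz ac1 c1z
  (regular_immersive sF rS1 lt1 ac1 c1t1).
have [z2 [S2 [sS2 rS2 S2z2 E2]]] := rj'; have [zz2 _] := jet_eq sS2 S2z2 E2.
rewrite -zz2 in S2z2; have [t2 lt2] := sS2 _ S2z2.
have t20 := local_param0 lt2; have st2 := nbhs_singleton (local_param_smooth lt2).
have c2t2 : cdom c2 (F (t2 0)) by rewrite t20.
have it2 := regular_immersive sF rS2 lt2 ac2 c2t2.
(* The second condition lives at [act g z]. Brought back to [z] by the inverse of [g], it concerns
   [F \o act g], so both conditions bear on one Jacobian in the chart [c]. *)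
pose t := act g^-1%g \o t2.
have st : smoothM AM t 0 := smoothM_map sg' st2.
have t0 : t 0 = z by rewrite /t /= t20 (actK act_lie).
have tE : c2 \o (F \o act g) \o t = c2 \o (F \o t2).
  by apply/funext => x; rewrite /t /= (actVK act_lie).
have f2 : row_free (derive_mxf (c \o t) 0 *m
    derive_mxf (c2 \o (F \o act g) \o cinv c) (c z)).
  apply: (chart_jacobian_free sFg st t0 ac cz ac2 c2z).
  by rewrite tE; exact: it2.
have [A [fA1 fA2]] := common_row_free f1 f2.
pose s (x : 'rV[R]_p) := cinv c (c z + x *m A).
have cL : continuous (mulmxr A : 'rV[R]_p -> 'rV[R]_m).
  exact: (linear_mx_continuous (L := mulmxr A)).
have s00 : s 0 = z by rewrite /s mul0mx addr0 cmapK.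
have i1 : injective ('d (c1 \o F \o s) 0).
  exact: (affine_chart_injective sF ac cz ac1 c1z fA1).
have i2 : injective ('d (c2 \o F \o (act g \o s)) 0).
  exact: (affine_chart_injective sFg ac cz ac2 c2z fA2).
exists s; split=> //.
- have cA : {for (0 : 'rV[R]_p), continuous (fun x => c z + mulmxr A x)}.
    exact: smooth_at_continuous (smooth_atD (smooth_at_cst _ _) (smooth_at_linear _ cL)).
  have ci : cimg c (c z + mulmxr A 0) by rewrite linear0 addr0; exact: cimg_map.
  have nc : \forall x \near (0 : 'rV[R]_p), cimg c (c z + mulmxr A x).
    exact: (cA _ (near_cimg ci)).
  apply: filterS nc => x cx.
  exact: (smoothM_affine cL (smoothM_cinv ac cx)).
- by split; [exists c1|exists c2].
- by move=> T lT; exact: contact_order0 ls0 lT.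
- by move=> T lT; exact: contact_order0 lgs0 lT.
Qed.

(** Both jets are rewritten with one patch [T] and its image under [act g], over a parameter set
    small enough for [regular_patch] to apply to [s] and to [act g \o s]; the two projections are
    then computed by [jet_projectionE]. *)
Lemma prolongation_projection g j j' :
  prolongation AM p k (act g) j j' ->
  regular_jets AM AN p k F j -> regular_jets AM AN p k F j' ->
  prolongation AN p k (effective_act F act (isotropy_coset F act g))
    (jet_projection AM AN p k F j) (jet_projection AM AN p k F j').
Proof.
move=> [z [S [[sS Sz] sgS -> ->]]] rj rj'.
have [s [ss s0 [[c1 [ac1 c1z i1]] [c2 [ac2 c2z i2]]] CS CgS]] :=
  transverse_param sS Sz sgS rj rj'.
have sg := @smooth_act _ _ _ _ _ _ _ _ act_lie g.
have sgs : \forall x \near (0 : 'rV[R]_p), smoothM AM (act g \o s) x.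
  by apply: filterS ss => x; exact: (smoothM_map sg).
rewrite -s0 in c1z c2z.
have [B1 nB1 H1] := regular_patch sF ss ac1 c1z i1.
have [B2 nB2 H2] := regular_patch sF sgs ac2 c2z i2.
have : nbhs (0 : 'rV[R]_p) (B1 `&` B2) by exact: filterI.
rewrite nbhsE => -[B [oB B_0] BB].
have [sT rT eT lT] := H1 B oB (subset_trans BB (@subIsetl _ _ _)) B_0.
have [sgT rgT egT lgT] := H2 B oB (subset_trans BB (@subIsetr _ _ _)) B_0.
set T := s @` B in sT rT eT lT.
have gTE : (act g \o s) @` B = act g @` T by rewrite -(image_comp s (act g) B).
rewrite gTE in sgT rgT egT lgT.
have sg0 : (act g \o s) 0 = act g z by rewrite /= s0.
rewrite s0 in lT; rewrite sg0 in lgT.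
have Tz := local_param_mem lT; have gTz := local_param_mem lgT.
rewrite (jet_contact (CS T lT)) (jet_contact (CgS _ lgT)).
rewrite (jet_projectionE k sF sT Tz rT eT) (jet_projectionE k sF sgT gTz rgT egT).
exists (F z), (F @` T); split.
- by split; [exact: (submanifold_image sF sT rT eT)|exists z].
- rewrite (effective_act_image F_onto act_lie act_proj).
  exact: (submanifold_image sF sgT rgT egT).
- by [].
- by rewrite (effective_act_image F_onto act_lie act_proj)
    (effective_actE F_onto act_lie act_proj).
Qed.

End Prolongation.

Theorem theorem6 (R : realType) (m n d p k : nat) (M N : topologicalType)
    (AM : manifold R m M) (AN : manifold R n N)
    (G : topGroupType) (LG : lie_group R d G)
    (Pi : M -> N) (act : G -> M -> M)
    (Pi_smooth : smooth_map AM AN Pi)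
    (Pi_onto : forall v : N, exists z : M, Pi z = v)
    (Pi_rank : constant_rank AM AN Pi)
    (p_ge1 : (1 <= p)%N) (p_lt_n : (p < n)%N) (n_lt_m : (n < m)%N)
    (act_lie : lie_action LG AM act)
    (act_projectable : projectable Pi act)
    (domI : set (jet_of N)) (I : jet_of N -> R)
    (I_invariant : differential_invariant AN p k
       (effective_group Pi act) (effective_act Pi act) domI I) :
  differential_invariant AM p k [set: G] act
    (regular_jets AM AN p k Pi `&` jet_projection AM AN p k Pi @^-1` domI)
    (I \o jet_projection AM AN p k Pi).
Proof.
have [dI invI] := I_invariant; split.
  exact: pullback_differential_function.
move=> g j j' _ gj [rj dj] [rj' dj'].
(* The projected jets are related by the coset of [g], an element of the effective group. *)
apply: (invI (isotropy_coset Pi act g)) => //; first by exists g.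
exact: (prolongation_projection Pi_smooth Pi_onto act_lie).
Qed.
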